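(* Let $(\mathfrak{g},B)$ be a quadratic Lie algebra, i.e. a finite-dimensional complex Lie algebra $\mathfrak{g}$ together with a non-degenerate symmetric bilinear form $B$ on $\mathfrak{g}$ satisfying $B([x,y],z)+B(y,[x,z])=0$ for all $x,y,z\in\mathfrak{g}$. Let $\mathcal{C}(\mathfrak{g})$ be the Clifford algebra of $(\mathfrak{g},B)$, let $v_{\mathfrak{g}}\in\mathcal{C}(\mathfrak{g})$ be the element defined by the fundamental $3$-form of $\mathfrak{g}$, let $\Omega_{\mathfrak{g}}\in\mathcal{U}(\mathfrak{g})$ be the Casimir element, and let $D_{\mathfrak{g}}\in\mathcal{U}(\mathfrak{g})\otimes\mathcal{C}(\mathfrak{g})$ be the cubic Dirac operator (all normalized as in the context). Then the square $v_{\mathfrak{g}}^2$, computed in the Clifford algebra $\mathcal{C}(\mathfrak{g})$, is a scalar $c_{\mathfrak{g}}\in\mathbb{C}$ (that is, $v_{\mathfrak{g}}^2=c_{\mathfrak{g}}\cdot 1$), and $$D_{\mathfrak{g}}^2=\Omega_{\mathfrak{g}}\otimes 1+c_{\mathfrak{g}}\,(1\otimes 1)$$ in $\mathcal{U}(\mathfrak{g})\otimes\mathcal{C}(\mathfrak{g})$.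
   Context: Clifford algebra: $\mathcal{C}(\mathfrak{g})$ is the quotient of the tensor algebra $T(\mathfrak{g})$ by the two-sided ideal generated by the elements $xy+yx-2B(x,y)$, $x,y\in\mathfrak{g}$. The underlying vector space of $\mathcal{C}(\mathfrak{g})$ is identified with the exterior algebra $\wedge\mathfrak{g}$ by the Chevalley isomorphism; under this identification, if $(X_i)$ is a basis of $\mathfrak{g}$ orthonormal for $B$, the element $X_{i_1}\wedge\cdots\wedge X_{i_k}$ ($i_1<\cdots<i_k$) corresponds to the Clifford product $X_{i_1}\cdots X_{i_k}$. Extension of $B$: $B$ is extended to a non-degenerate symmetric bilinear form on $\wedge\mathfrak{g}$, with distinct degrees orthogonal, by $B(x_1\wedge\cdots\wedge x_k,\,y_1\wedge\cdots\wedge y_k)=\det\big(B(x_i,y_j)\big)_{i,j}$. Fundamental $3$-form: $v_{\mathfrak{g}}\in\wedge^3\mathfrak{g}\subset\mathcal{C}(\mathfrak{g})$ is the unique element such that $B(v_{\mathfrak{g}},x\wedge y\wedge z)=-\tfrac12 B(x,[y,z])$ for all $x,y,z\in\mathfrak{g}$. Casimir element and cubic Dirac operator: let $\mathcal{U}(\mathfrak{g})$ be the universal enveloping algebra of $\mathfrak{g}$ and $(X_i)$ a basis of $\mathfrak{g}$ orthonormal for $B$. Then $\Omega_{\mathfrak{g}}=\sum_i X_i^2\in\mathcal{U}(\mathfrak{g})$ and $$D_{\mathfrak{g}}=\sum_i X_i\otimes X_i+1\otimes v_{\mathfrak{g}}\in\mathcal{U}(\mathfrak{g})\otimes\mathcal{C}(\mathfrak{g}).$$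 These elements do not depend on the choice of orthonormal basis. The algebra $\mathcal{U}(\mathfrak{g})\otimes\mathcal{C}(\mathfrak{g})$ has the usual product $(a\otimes u)(b\otimes w)=ab\otimes uw$. *)

(* Defs.v *)
From HB Require Import structures.
From mathcomp Require Import all_boot all_order all_algebra perm.
From mathcomp Require Import finmap complex monalg.
From mathcomp Require Import boolp classical_sets reals generic_quotient.

Set Implicit Arguments.
Unset Strict Implicit.
Unset Printing Implicit Defensive.

Import GRing.Theory.
Local Open Scope ring_scope.
Local Open Scope quotient_scope.

(* Associative unital K-algebras, given by a ring morphism from K to the centre.
   The library's algType also demands 1 != 0, which would have to be proved of
   every quotient before it could even be named. *)
HB.mixin Record PzRing_isPzAlgebra (K : pzRingType) A of GRing.PzRing A := {
  alg_map : K -> A;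
  alg_mapD : {morph alg_map : c d / c + d};
  alg_mapM : {morph alg_map : c d / c * d};
  alg_map1 : alg_map 1 = 1;
  alg_mapC : forall c a, alg_map c * a = a * alg_map c
}.
#[short(type="pzAlgType")]
HB.structure Definition PzAlgebra (K : pzRingType) :=
  {A of GRing.PzRing A & PzRing_isPzAlgebra K A}.

Section LinearExtension.
Variables (K : comNzRingType) (M : choiceType) (W : lmodType K).
Implicit Type f : M -> W.

Definition lin_ext f (a : {malg K[M]}) : W :=
  \sum_(m <- msupp a) a@_m *: f m.

Lemma lin_extEw f (d : {fset M}) a : (msupp a `<=` d)%fset ->
  lin_ext f a = \sum_(m <- d) a@_m *: f m.
Proof.
move=> le; rewrite [LHS](big_fset_incl _ le) => //= x xd /mcoeff_outdom ->.
by rewrite scale0r.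
Qed.

Lemma lin_extU f c m : lin_ext f << c *g m >> = c *: f m.
Proof. by rewrite (lin_extEw _ msuppU_le) big_seq_fset1 mcoeffUU. Qed.

Lemma lin_ext_is_linear f : linear (lin_ext f).
Proof.
move=> c a b.
pose d := (msupp (c *: a + b) `|` msupp a `|` msupp b)%fset.
have h1 : (msupp (c *: a + b) `<=` d)%fset by rewrite /d -fsetUA fsubsetUl.
have h2 : (msupp a `<=` d)%fset.
  by rewrite /d fsetUAC fsubsetUr.
have h3 : (msupp b `<=` d)%fset by rewrite /d fsubsetUr.
rewrite (lin_extEw _ h1) (lin_extEw _ h2) (lin_extEw _ h3).
rewrite scaler_sumr -big_split /=; apply: eq_bigr => m _.
by rewrite mcoeffD mcoeffZ scalerDl scalerA.
Qed.
HB.instance Definition _ f :=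
  GRing.isLinear.Build K {malg K[M]} W *:%R (lin_ext f) (lin_ext_is_linear f).

Lemma lin_extP f c f1 f2 : (forall m, f m = c *: f1 m + f2 m) ->
  forall a, lin_ext f a = c *: lin_ext f1 a + lin_ext f2 a.
Proof.
move=> h a; rewrite /lin_ext scaler_sumr -big_split /=; apply: eq_bigr => m _.
by rewrite h scalerDr !scalerA mulrC.
Qed.

Lemma lin_ext0 f : (forall m, f m = 0) -> forall a, lin_ext f a = 0.
Proof. by move=> h a; rewrite /lin_ext big1 // => m _; rewrite h scaler0. Qed.

End LinearExtension.

(* The monoid algebra K[M]. The library's product on {malg K[M]} only covers
   monoids without non-trivial units, which excludes the multiplicative monoid
   A * B used below for tensor products. *)
Definition monoid_alg (K : comNzRingType) (M : monoidType) := {malg K[M]}.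

Definition mon (K : comNzRingType) (M : monoidType) (m : M) : monoid_alg K M := << m >>.

HB.lock Definition mon_mul (K : comNzRingType) (M : monoidType)
    (a b : monoid_alg K M) : monoid_alg K M :=
  lin_ext (fun m => lin_ext (fun m' => mon K (m * m')%g) b) a.

Section MonoidAlgebra.
Variables (K : comNzRingType) (M : monoidType).

Local Notation mon_alg := (monoid_alg K M).
Local Notation mon := (@mon K M).
Local Notation mon_mul := (@mon_mul K M).
HB.instance Definition _ := GRing.Lmodule.on mon_alg.


Lemma mon_ind (P : mon_alg -> Prop) :
  (forall m, P (mon m)) -> P 0 -> (forall c a b, P a -> P b -> P (c *: a + b)) ->
  forall a, P a.
Proof.
move=> h1 h0 hl a; rewrite [a]monalgE; elim/big_rec: _ => // m x _ hx.
have -> : << a@_m *g m >> = a@_m *: mon m; last by apply: hl.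
by apply/malgP => k; rewrite mcoeffZ !mcoeffU mulrnAr mulr1.
Qed.

Lemma mon_mulDl c a a' b : mon_mul (c *: a + a') b = c *: mon_mul a b + mon_mul a' b.
Proof. by rewrite unlock lin_ext_is_linear. Qed.

Lemma mon_mulDr c a b b' : mon_mul a (c *: b + b') = c *: mon_mul a b + mon_mul a b'.
Proof.
rewrite unlock; apply: lin_extP => m; exact: lin_ext_is_linear.
Qed.

Lemma mon_mul0l b : mon_mul 0 b = 0.
Proof. by rewrite unlock linear0. Qed.

Lemma mon_mul0r a : mon_mul a 0 = 0.
Proof. by rewrite unlock; apply: lin_ext0 => m; rewrite linear0. Qed.

Lemma mon_mulE m m' : mon_mul (mon m) (mon m') = mon (m * m')%g.
Proof. by rewrite unlock !lin_extU !scale1r. Qed.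

Lemma mon_mulA : associative mon_mul.
Proof.
move=> a; elim/mon_ind: a => [m||c a a' ha ha'] b d; last 2 first.
- by rewrite !mon_mul0l.
- by rewrite !mon_mulDl ha ha'.
elim/mon_ind: b => [m'||c b b' hb hb']; last 2 first.
- by rewrite !(mon_mul0l, mon_mul0r).
- by rewrite !(mon_mulDl, mon_mulDr) hb hb'.
elim/mon_ind: d => [m''||c d d' hd hd']; last 2 first.
- by rewrite !mon_mul0r.
- by rewrite !mon_mulDr hd hd'.
by rewrite !mon_mulE mulgA.
Qed.

Lemma mon_mul1l : left_id (mon 1%g) mon_mul.
Proof.
move=> a; elim/mon_ind: a => [m||c a a' ha ha'].
- by rewrite mon_mulE mul1g.
- exact: mon_mul0r.
- by rewrite mon_mulDr ha ha'.
Qed.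

Lemma mon_mul1r : right_id (mon 1%g) mon_mul.
Proof.
move=> a; elim/mon_ind: a => [m||c a a' ha ha'].
- by rewrite mon_mulE mulg1.
- exact: mon_mul0l.
- by rewrite mon_mulDl ha ha'.
Qed.

Lemma mon_mul_addl : left_distributive mon_mul +%R.
Proof. by move=> a b d; have := mon_mulDl 1 a b d; rewrite !scale1r. Qed.

Lemma mon_mul_addr : right_distributive mon_mul +%R.
Proof. by move=> a b d; have := mon_mulDr 1 a b d; rewrite !scale1r. Qed.

HB.instance Definition _ := GRing.Zmodule_isPzRing.Build mon_alg
  mon_mulA mon_mul1l mon_mul1r mon_mul_addl mon_mul_addr.

Lemma mon_scalerAl (c : K) (a b : mon_alg) : c *: (a * b) = (c *: a) * b.
Proof. by have := mon_mulDl c a 0 b; rewrite mon_mul0l !addr0. Qed.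

Lemma mon_scalerAr (c : K) (a b : mon_alg) : c *: (a * b) = a * (c *: b).
Proof. by have := mon_mulDr c a b 0; rewrite mon_mul0r !addr0. Qed.

Definition mon_const (c : K) : mon_alg := c *: (1 : mon_alg).

Lemma mon_constE c a : mon_const c * a = c *: a.
Proof. by rewrite -mon_scalerAl mul1r. Qed.
Lemma mon_constD : {morph mon_const : c d / c + d}.
Proof. by move=> c d; rewrite -scalerDl. Qed.
Lemma mon_constM : {morph mon_const : c d / c * d}.
Proof. by move=> c d; rewrite mon_constE scalerA. Qed.
Lemma mon_const1 : mon_const 1 = 1. Proof. exact: scale1r. Qed.
Lemma mon_constC c a : mon_const c * a = a * mon_const c.
Proof. by rewrite mon_constE -mon_scalerAr mulr1. Qed.

HB.instance Definition _ := PzRing_isPzAlgebra.Build K mon_alg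
  mon_constD mon_constM mon_const1 mon_constC.

Lemma mon_alg_mapE c (a : mon_alg) : alg_map c * a = c *: a.
Proof. exact: mon_constE. Qed.

Lemma monM m m' : mon m * mon m' = mon (m * m')%g.
Proof. exact: mon_mulE. Qed.

End MonoidAlgebra.

Section QuotientDef.
Variables (K : pzRingType) (A : pzAlgType K) (S : set A).

Inductive gen_ideal : A -> Prop :=
| GenIdeal_mem a : S a -> gen_ideal a
| GenIdeal0 : gen_ideal 0
| GenIdealD a b : gen_ideal a -> gen_ideal b -> gen_ideal (a + b)
| GenIdealMl a b : gen_ideal b -> gen_ideal (a * b)
| GenIdealMr a b : gen_ideal a -> gen_ideal (a * b).

Definition gen_ideal_pred : {pred A} := fun a => `[< gen_ideal a >].

Lemma gen_idealP a : reflect (gen_ideal a) (a \in gen_ideal_pred).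
Proof. exact: asboolP. Qed.

Lemma gen_ideal_zmod_closed : zmod_closed gen_ideal_pred.
Proof.
split=> [|a b /gen_idealP ha /gen_idealP hb]; apply/gen_idealP.
  exact: GenIdeal0.
by apply: GenIdealD => //; rewrite -mulN1r; apply: GenIdealMl.
Qed.
HB.instance Definition _ :=
  GRing.isZmodClosed.Build A gen_ideal_pred gen_ideal_zmod_closed.

Definition quot_alg := Quotient.quot gen_ideal_pred.
HB.instance Definition _ := GRing.Zmodule.on quot_alg.
HB.instance Definition _ := Choice.on quot_alg.
HB.instance Definition _ := Quotient.on quot_alg.

Definition quot_pi (a : A) : quot_alg := \pi_quot_alg a.

Lemma quot_piP a b : quot_pi a = quot_pi b <-> gen_ideal (a - b).
Proof.
rewrite /quot_pi; split=> [/eqP|h].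
  by rewrite -Quotient.idealrBE => /gen_idealP.
by apply/eqP; rewrite -Quotient.idealrBE; apply/gen_idealP.
Qed.

Lemma quot_reprK (x : quot_alg) : quot_pi (repr x) = x.
Proof. exact: reprK. Qed.

Lemma quot_piD a b : quot_pi (a + b) = quot_pi a + quot_pi b.
Proof. exact: Quotient.pi_add. Qed.

End QuotientDef.

HB.lock Definition quot_mul (K : pzRingType) (A : pzAlgType K) (S : set A)
    (x y : quot_alg S) : quot_alg S := quot_pi S (repr x * repr y).
HB.lock Definition quot_scale (K : pzRingType) (A : pzAlgType K) (S : set A)
    (c : K) (x : quot_alg S) : quot_alg S := quot_pi S (alg_map c * repr x).

Section QuotientAlgebra.
Variables (K : pzRingType) (A : pzAlgType K) (S : set A).

Local Notation gen_ideal := (gen_ideal S).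
Local Notation quot_alg := (quot_alg S).
Local Notation quot_pi := (quot_pi S).
Local Notation quot_mul := (@quot_mul K A S).
Local Notation quot_scale := (@quot_scale K A S).

Definition quot_one : quot_alg := quot_pi 1.
Lemma quot_mulE a b : quot_mul (quot_pi a) (quot_pi b) = quot_pi (a * b).
Proof.
rewrite unlock; apply/quot_piP.
set a' := repr _; set b' := repr _.
have -> : a' * b' - a * b = a' * (b' - b) + (a' - a) * b.
  by rewrite mulrBr mulrBl addrA subrK.
apply: GenIdealD.
  by apply: GenIdealMl; apply/quot_piP; rewrite quot_reprK.
by apply: GenIdealMr; apply/quot_piP; rewrite quot_reprK.
Qed.

Lemma quot_ind (P : quot_alg -> Prop) : (forall a, P (quot_pi a)) -> forall x, P x.
Proof. by move=> h x; rewrite -[x]quot_reprK. Qed.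

Lemma quot_mulA : associative quot_mul.
Proof.
move=> x y z; elim/quot_ind: x => a; elim/quot_ind: y => b; elim/quot_ind: z => d.
by rewrite !quot_mulE mulrA.
Qed.
Lemma quot_mul1l : left_id quot_one quot_mul.
Proof. by move=> x; elim/quot_ind: x => a; rewrite quot_mulE mul1r. Qed.
Lemma quot_mul1r : right_id quot_one quot_mul.
Proof. by move=> x; elim/quot_ind: x => a; rewrite quot_mulE mulr1. Qed.
Lemma quot_mulDl : left_distributive quot_mul +%R.
Proof.
move=> x y z; elim/quot_ind: x => a; elim/quot_ind: y => b; elim/quot_ind: z => d.
by rewrite -quot_piD !quot_mulE -quot_piD mulrDl.
Qed.
Lemma quot_mulDr : right_distributive quot_mul +%R.
Proof.
move=> x y z; elim/quot_ind: x => a; elim/quot_ind: y => b; elim/quot_ind: z => d.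
by rewrite -quot_piD !quot_mulE -quot_piD mulrDr.
Qed.
HB.instance Definition _ := GRing.Zmodule_isPzRing.Build quot_alg
  quot_mulA quot_mul1l quot_mul1r quot_mulDl quot_mulDr.

Lemma quot_piM a b : quot_pi (a * b) = quot_pi a * quot_pi b.
Proof. by rewrite -quot_mulE. Qed.

Definition quot_const (c : K) : quot_alg := quot_pi (alg_map c).
Lemma quot_constD : {morph quot_const : c d / c + d}.
Proof. by move=> c d; rewrite /quot_const alg_mapD quot_piD. Qed.
Lemma quot_constM : {morph quot_const : c d / c * d}.
Proof. by move=> c d; rewrite /quot_const alg_mapM quot_piM. Qed.
Lemma quot_const1 : quot_const 1 = 1.
Proof. by rewrite /quot_const alg_map1. Qed.
Lemma quot_constC c x : quot_const c * x = x * quot_const c.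
Proof. by elim/quot_ind: x => a; rewrite -!quot_piM alg_mapC. Qed.
HB.instance Definition _ := PzRing_isPzAlgebra.Build K quot_alg
  quot_constD quot_constM quot_const1 quot_constC.

Lemma quot_scaleE c x : quot_scale c x = quot_const c * x.
Proof. by rewrite unlock quot_piM quot_reprK. Qed.
Lemma quot_scaleA c d x : quot_scale c (quot_scale d x) = quot_scale (c * d) x.
Proof. by rewrite !quot_scaleE mulrA quot_constM. Qed.
Lemma quot_scale1 : left_id 1 quot_scale.
Proof. by move=> x; rewrite quot_scaleE quot_const1 mul1r. Qed.
Lemma quot_scaleDr : right_distributive quot_scale +%R.
Proof. by move=> c x y; rewrite !quot_scaleE mulrDr. Qed.
Lemma quot_scaleDl x : {morph quot_scale^~ x : c d / c + d}.
Proof. by move=> c d; rewrite !quot_scaleE quot_constD mulrDl. Qed.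
HB.instance Definition _ := GRing.Zmodule_isLmodule.Build K quot_alg
  quot_scaleA quot_scale1 quot_scaleDr quot_scaleDl.

Lemma quot_alg_mapE c (x : quot_alg) : alg_map c * x = c *: x.
Proof. by rewrite -quot_scaleE. Qed.
Lemma quot_scalerAl (c : K) (x y : quot_alg) : c *: (x * y) = (c *: x) * y.
Proof. by rewrite -!quot_alg_mapE mulrA. Qed.
Lemma quot_scalerAr (c : K) (x y : quot_alg) : c *: (x * y) = x * (c *: y).
Proof. by rewrite -!quot_alg_mapE !mulrA alg_mapC. Qed.
Lemma quot_piZ c a : quot_pi (alg_map c * a) = c *: quot_pi a.
Proof. by rewrite quot_piM -quot_alg_mapE. Qed.
Lemma quot_pi_is_additive : zmod_morphism quot_pi.
Proof. by move=> a b; rewrite quot_piD; congr (_ + _); apply: Quotient.pi_opp. Qed.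
HB.instance Definition _ :=
  GRing.isZmodMorphism.Build A quot_alg quot_pi quot_pi_is_additive.
Lemma quot_pi1 : quot_pi 1 = 1. Proof. by []. Qed.

Lemma quot_pi0 a : S a -> quot_pi a = 0.
Proof. by move=> h; rewrite -[RHS](raddf0 quot_pi); apply/quot_piP; rewrite subr0; apply: GenIdeal_mem. Qed.

(* The map induced by f on the quotient; meaningful when f is additive and
   vanishes on the ideal (see quot_liftE). *)
Definition quot_lift (W : Type) (f : A -> W) (x : quot_alg) : W := f (repr x).

Lemma quot_liftE (W : zmodType) (f : A -> W) : zmod_morphism f ->
    (forall a s b, S s -> f (a * s * b) = 0) ->
  forall a, quot_lift f (quot_pi a) = f a.
Proof.
move=> fB fS a; apply/eqP; rewrite -subr_eq0 -fB; apply/eqP.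
have f0 : f 0 = 0 by have := fB 0 0; rewrite !subrr.
have fD x y : f (x + y) = f x + f y.
  have fN : f (- y) = - f y by rewrite -[- y]sub0r fB f0 sub0r.
  by have := fB x (- y); rewrite opprK fN opprK.
suff h x : gen_ideal x -> forall b d, f (b * x * d) = 0.
  rewrite -[repr _ - a]mulr1 -[repr _ - a]mul1r; apply: h.
  by apply/quot_piP; rewrite quot_reprK.
elim=> {x} [x Sx|| x y _ hx _ hy | x y _ hy | x y _ hx] b d.
- exact: fS.
- by rewrite mulr0 mul0r.
- by rewrite mulrDr mulrDl fD hx hy addr0.
- by rewrite mulrA hy.
- by rewrite mulrA -[b * x * y * d]mulrA hx.
Qed.

End QuotientAlgebra.

(* The free monoid on X. *)
Definition words (X : choiceType) := seq X.
HB.instance Definition _ (X : choiceType) := Choice.on (words X).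
HB.instance Definition _ (X : choiceType) :=
  isMonoid.Build (words X) (@catA X) (@cat0s X) (@cats0 X).

(* The tensor algebra T(V): the algebra of the free monoid on the set V, in
   which the letters are made to depend linearly on the vectors. *)
Section TensorAlgebra.
Variables (K : comNzRingType) (V : lmodType K).

Local Notation word_alg := (monoid_alg K (words V)).
Definition word (w : seq V) : word_alg := mon K (w : words V).

Definition tens_rel : set word_alg :=
  [set t | exists (c : K) (x y : V),
     t = word [:: c *: x + y] - (c *: word [:: x] + word [:: y])].

Local Notation tens_alg := (quot_alg tens_rel).

Definition tens_in (x : V) : tens_alg := quot_pi tens_rel (word [:: x]).

Lemma tens_in_is_linear : linear tens_in.
Proof.
move=> c x y; rewrite /tens_in -quot_piZ mon_alg_mapE -quot_piD; apply/quot_piP.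
by apply: GenIdeal_mem; exists c, x, y.
Qed.
HB.instance Definition _ :=
  GRing.isLinear.Build K V tens_alg *:%R tens_in tens_in_is_linear.

Lemma tens_prod_in w : \prod_(x <- w) tens_in x = quot_pi tens_rel (word w).
Proof.
elim: w => [|x w IHw]; first by rewrite big_nil.
by rewrite big_cons IHw -quot_piM monM.
Qed.

Lemma tens_ind (P : tens_alg -> Prop) :
  (forall w, P (\prod_(x <- w) tens_in x)) -> P 0 ->
  (forall c a b, P a -> P b -> P (c *: a + b)) -> forall a, P a.
Proof.
move=> h1 h0 hl a; elim/quot_ind: a => a.
elim/mon_ind: a => [w||c a b ha hb].
- by rewrite -tens_prod_in.
- by rewrite raddf0.
- by rewrite quot_piD -mon_alg_mapE quot_piZ; apply: hl.
Qed.

Variable W : lmodType K.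
Implicit Type f : seq V -> W.

Definition multilinear f := forall w1 w2 c x y,
  f (w1 ++ (c *: x + y) :: w2) = c *: f (w1 ++ x :: w2) + f (w1 ++ y :: w2).

(* The linear map with x1 (x) ... (x) xk |-> f [:: x1; ...; xk]. *)
Definition tens_lift f : tens_alg -> W := quot_lift (lin_ext f : word_alg -> W).

Lemma tens_lift_pi f : multilinear f ->
  forall a, tens_lift f (quot_pi tens_rel a) = lin_ext f a.
Proof.
move=> fl; apply: quot_liftE => [a b|a _ b [c [x [y ->]]]]; first exact: raddfB.
elim/mon_ind: a => [w1||d a a' ha ha']; last 2 first.
- by rewrite !mul0r raddf0.
- by rewrite !mulrDl -!mon_scalerAl linearP /= ha ha' scaler0 addr0.
elim/mon_ind: b => [w2||d a a' ha ha']; last 2 first.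
- by rewrite mulr0 raddf0.
- rewrite [_ * (d *: a + a')]mulrDr -mon_scalerAr.
  by apply: etrans (lin_ext_is_linear _ _ _ _) _; rewrite ha ha' scaler0 addr0.
rewrite mulrBr mulrDr mulrBl mulrDl -mon_scalerAr -mon_scalerAl.
have wE u : word w1 * word [:: u] * word w2 = word (w1 ++ u :: w2).
  by rewrite !monM; congr mon; rewrite -[RHS]/(w1 ++ [:: u] ++ w2) catA.
rewrite raddfB /= (lin_ext_is_linear f) -/(word w1) -/(word w2) !wE.
by rewrite !lin_extU !scale1r fl subrr.
Qed.

Lemma tens_liftE f : multilinear f ->
  forall w, tens_lift f (\prod_(x <- w) tens_in x) = f w.
Proof. by move=> fl w; rewrite tens_prod_in tens_lift_pi // lin_extU scale1r. Qed.

Lemma tens_lift_is_linear f : multilinear f -> linear (tens_lift f).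
Proof.
move=> fl c a b; elim/quot_ind: a => a; elim/quot_ind: b => b.
by rewrite -quot_piZ -quot_piD !tens_lift_pi // mon_alg_mapE linearP.
Qed.

End TensorAlgebra.

Notation tens_alg V := (quot_alg (@tens_rel _ V)).

Section ExteriorAlgebra.
Variables (K : comNzRingType) (V : lmodType K).

Definition ext_rel : set (tens_alg V) := [set t | exists x, t = tens_in x * tens_in x].

Local Notation ext_alg := (quot_alg ext_rel).

Definition ext_in (x : V) : ext_alg := quot_pi ext_rel (tens_in x).

Lemma ext_in_is_linear : linear ext_in.
Proof. by move=> c x y; rewrite /ext_in -quot_piZ quot_alg_mapE -quot_piD linearP. Qed.
HB.instance Definition _ :=
  GRing.isLinear.Build K V ext_alg *:%R ext_in ext_in_is_linear.

Lemma ext_prod_in w :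
  \prod_(x <- w) ext_in x = quot_pi ext_rel (\prod_(x <- w) tens_in x).
Proof.
elim: w => [|x w IHw]; first by rewrite !big_nil.
by rewrite !big_cons IHw -quot_piM.
Qed.

Lemma ext_ind (P : ext_alg -> Prop) :
  (forall w, P (\prod_(x <- w) ext_in x)) -> P 0 ->
  (forall c a b, P a -> P b -> P (c *: a + b)) -> forall a, P a.
Proof.
move=> h1 h0 hl a; elim/quot_ind: a => a.
elim/tens_ind: a => [w||c a b ha hb].
- by rewrite -ext_prod_in.
- by rewrite raddf0.
- by rewrite quot_piD -quot_alg_mapE quot_piZ; apply: hl.
Qed.

(* The homogeneous part of degree k. *)
Definition ext_degree (k : nat) : set ext_alg :=
  [set a | exists n (c : 'I_n -> K) (x : 'I_n -> k.-tuple V),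
     a = \sum_(i < n) c i *: \prod_(u <- x i) ext_in u].

Variable W : lmodType K.
Implicit Type f : seq V -> W.

Definition alternating f := forall w1 w2 x, f (w1 ++ x :: x :: w2) = 0.

(* The linear map with x1 /\ ... /\ xk |-> f [:: x1; ...; xk]. *)
Definition ext_lift f : ext_alg -> W := quot_lift (tens_lift f).

Lemma ext_lift_pi f : multilinear f -> alternating f ->
  forall a, ext_lift f (quot_pi ext_rel a) = tens_lift f a.
Proof.
move=> fl fa.
have fP := tens_lift_is_linear fl.
have f0 : tens_lift f 0 = 0 by have := fP (-1) 0 0; rewrite scaler0 scaleN1r addr0 addNr.
have fB a b : tens_lift f (a - b) = tens_lift f a - tens_lift f b.
  by have := fP (-1) b a; rewrite !scaleN1r [- b + a]addrC [- tens_lift f b + _]addrC.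
apply: quot_liftE => [a b|a _ b [x ->]]; first exact: fB.
elim/tens_ind: a => [w1||d a a' ha ha']; last 2 first.
- by rewrite !mul0r f0.
- by rewrite !mulrDl -!quot_scalerAl fP ha ha' scaler0 addr0.
elim/tens_ind: b => [w2||d a a' ha ha']; last 2 first.
- by rewrite mulr0 f0.
- by rewrite !mulrDr -!quot_scalerAr fP ha ha' scaler0 addr0.
rewrite -[RHS](fa w1 w2 x) -(tens_liftE fl) big_cat !big_cons /=.
by rewrite !mulrA.
Qed.

Lemma ext_liftE f : multilinear f -> alternating f ->
  forall w, ext_lift f (\prod_(x <- w) ext_in x) = f w.
Proof. by move=> fl fa w; rewrite ext_prod_in ext_lift_pi // tens_liftE. Qed.

Lemma ext_lift_is_linear f : multilinear f -> alternating f -> linear (ext_lift f).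
Proof.
move=> fl fa c a b; elim/quot_ind: a => a; elim/quot_ind: b => b.
by rewrite -quot_piZ -quot_piD !ext_lift_pi // quot_alg_mapE tens_lift_is_linear.
Qed.

End ExteriorAlgebra.

Notation ext_alg V := (quot_alg (@ext_rel _ V)).

Section ExteriorForm.
Variables (K : comNzRingType) (V : lmodType K) (B : V -> V -> K).

Definition gram n (x y : nat -> V) : K := \det (\matrix_(i < n, j < n) B (x i) (y j)).

Definition word_form (w w' : seq V) : K^o :=
  if size w == size w' then gram (size w) (nth 0 w) (nth 0 w') else 0.

(* The extension of B to the exterior algebra (see ext_formE). *)
Definition ext_form (a b : ext_alg V) : K :=
  ext_lift (fun w => ext_lift (word_form w) b) a.

Hypothesis Bl : forall x, linear (B x : V -> K^o).
Hypothesis BC : forall x y, B x y = B y x.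

Lemma gramC n x y : gram n x y = gram n y x.
Proof. by rewrite /gram -det_tr; congr determinant; apply/matrixP=> i j; rewrite !mxE. Qed.

Lemma word_formC w w' : word_form w w' = word_form w' w.
Proof. by rewrite /word_form eq_sym; case: eqP => // ->; rewrite gramC. Qed.

Lemma nth_mid (w1 w2 : seq V) u : nth 0 (w1 ++ u :: w2) (size w1) = u.
Proof. by rewrite nth_cat ltnn subnn. Qed.

Lemma nth_mid_neq (w1 w2 : seq V) u v i : i != size w1 ->
  nth 0 (w1 ++ u :: w2) i = nth 0 (w1 ++ v :: w2) i.
Proof. by rewrite !nth_cat; case: ltngtP => // h _; rewrite -(subnSK h). Qed.

Lemma size_mid (w1 w2 : seq V) u : size (w1 ++ u :: w2) = (size w1 + (size w2).+1)%N.
Proof. by rewrite size_cat. Qed.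

Lemma word_form_multilinear w' : multilinear (word_form^~ w').
Proof.
move=> w1 w2 c x y; rewrite /word_form !size_mid.
case: ifP => _; last by rewrite scaler0 addr0.
set n := (_ + _)%N.
have lt_n : (size w1 < n)%N by rewrite /n addnS ltnS leq_addr.
rewrite /gram (determinant_multilinear (i0 := Ordinal lt_n) (b := c) (c := 1)
  (B := \matrix_(i < n, j < n) B (nth 0 (w1 ++ x :: w2) i) (nth 0 w' j))
  (C := \matrix_(i < n, j < n) B (nth 0 (w1 ++ y :: w2) i) (nth 0 w' j))) ?mul1r //.
- by apply/rowP=> j; rewrite !mxE mul1r !nth_mid BC (Bl _ c x y) !(BC (nth 0 w' j)).
- apply/matrixP=> i j; rewrite !mxE; congr (B _ _); apply: nth_mid_neq.
  by have := neq_lift (Ordinal lt_n) i; rewrite -val_eqE eq_sym.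
- apply/matrixP=> i j; rewrite !mxE; congr (B _ _); apply: nth_mid_neq.
  by have := neq_lift (Ordinal lt_n) i; rewrite -val_eqE eq_sym.
Qed.

Lemma word_form_alternating w' : alternating (word_form^~ w').
Proof.
move=> w1 w2 x; rewrite /word_form; case: ifP => // _.
rewrite size_mid /=; set n := (_ + _)%N.
have lt_n : (size w1 < n)%N by rewrite /n addnS ltnS leq_addr.
have lt_n' : ((size w1).+1 < n)%N by rewrite /n !addnS !ltnS leq_addr.
apply: (determinant_alternate (i1 := Ordinal lt_n) (i2 := Ordinal lt_n')).
  by rewrite -val_eqE /= ltn_eqF.
by move=> j; rewrite !mxE /= !nth_cat ltnn subnn ltnNge leqnSn /= subSnn.
Qed.

Lemma word_formr_multilinear w : multilinear (word_form w).
Proof. by move=> w1 w2 c x y; rewrite !(word_formC w) word_form_multilinear. Qed.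

Lemma word_formr_alternating w : alternating (word_form w).
Proof. by move=> w1 w2 x; rewrite word_formC word_form_alternating. Qed.

Lemma ext_form_multilinear b : multilinear (fun w => ext_lift (word_form w) b).
Proof.
by move=> w1 w2 c x y; apply: lin_extP => w'; apply: word_form_multilinear.
Qed.

Lemma ext_form_alternating b : alternating (fun w => ext_lift (word_form w) b).
Proof. by move=> w1 w2 x; apply: lin_ext0 => w'; apply: word_form_alternating. Qed.

Lemma ext_formE (w w' : seq V) :
  ext_form (\prod_(x <- w) ext_in x) (\prod_(y <- w') ext_in y) =
  if size w == size w'
  then \det (\matrix_(i < size w, j < size w) B w`_i w'`_j) else 0.
Proof.
rewrite /ext_form ext_liftE; last first.
- exact: ext_form_alternating.
- exact: ext_form_multilinear.
by rewrite ext_liftE //; [apply: word_formr_multilinear|apply: word_formr_alternating].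
Qed.

Lemma ext_form_linearl b : linear (ext_form^~ b : ext_alg V -> K^o).
Proof. exact: ext_lift_is_linear (ext_form_multilinear b) (ext_form_alternating b). Qed.

Lemma ext_form_linearr a : linear (ext_form a : ext_alg V -> K^o).
Proof.
move=> c b b'; apply: lin_extP => w.
exact: ext_lift_is_linear (word_formr_multilinear w) (word_formr_alternating w) _ _ _.
Qed.

End ExteriorForm.

Section CliffordAlgebra.
Variables (K : fieldType) (V : lmodType K) (B : V -> V -> K).

Definition cliff_rel : set (tens_alg V) :=
  [set t | exists x y, t = tens_in x * tens_in y + tens_in y * tens_in x
                           - (2 * B x y) *: (1 : tens_alg V)].

Local Notation cliff_alg := (quot_alg cliff_rel).

Definition cliff_in (x : V) : cliff_alg := quot_pi cliff_rel (tens_in x).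

Lemma cliff_in_is_linear : linear cliff_in.
Proof. by move=> c x y; rewrite /cliff_in -quot_piZ quot_alg_mapE -quot_piD linearP. Qed.
HB.instance Definition _ :=
  GRing.isLinear.Build K V cliff_alg *:%R cliff_in cliff_in_is_linear.

Lemma cliff_inM x y :
  cliff_in x * cliff_in y + cliff_in y * cliff_in x = (2 * B x y) *: (1 : cliff_alg).
Proof.
rewrite -!quot_piM -quot_piD -(quot_pi1 cliff_rel) -quot_piZ quot_alg_mapE.
apply/quot_piP; apply: GenIdeal_mem; by exists x, y; rewrite /tens_in -!quot_piM.
Qed.

Definition antisym (w : seq V) : cliff_alg :=
  ((size w)`!)%:R^-1 *:
    \sum_(s : 'S_(size w)) (-1) ^+ s *: \prod_(i < size w) cliff_in w`_(s i).

(* The Chevalley map, as antisymmetrisation (see chevalleyE); on the exterior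
   product of an orthogonal family it is the Clifford product
   (see chevalley_orthogonal). *)
Definition chevalley : ext_alg V -> cliff_alg := ext_lift antisym.

End CliffordAlgebra.

Section Anticommuting.
Variable A : pzRingType.

Lemma prod_lift_anti n (F : 'I_n.+1 -> A) (j : 'I_n.+1) :
  (forall i k, i != k -> F i * F k = - (F k * F i)) ->
  F j * \prod_(i < n) F (lift j i) = (-1) ^+ j * \prod_(i < n.+1) F i.
Proof.
elim: n => [|n IHn] in F j *; move=> aF.
  by rewrite (ord1 j) expr0 mul1r big_ord_recl.
case: (unliftP ord0 j) => [k ->|->]; last by rewrite expr0 mul1r [in RHS]big_ord_recl.
rewrite big_ord_recl mulrA.
have -> : lift (lift ord0 k) ord0 = ord0 by apply: val_inj.
rewrite aF 1?eq_sym ?neq_lift // mulNr -mulrA.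
under eq_bigr => i _.
  have -> : lift (lift ord0 k) (lift ord0 i) = lift ord0 (lift k i).
    by apply: val_inj; rewrite /= /bump /= !add1n ltnS addnS.
over.
rewrite (IHn (F \o lift ord0)) => [|i l il]; last first.
  by apply: aF; rewrite (inj_eq lift_inj).
rewrite [in RHS]big_ord_recl /= /bump /= add1n exprS mulN1r mulNr.
by rewrite !mulrA -signr_odd; congr (- (_ * _)); rewrite commr_sign.
Qed.

Lemma prod_perm_anti n (F : 'I_n -> A) (s : 'S_n) :
  (forall i k, i != k -> F i * F k = - (F k * F i)) ->
  \prod_(i < n) F (s i) = (-1) ^+ s * \prod_(i < n) F i.
Proof.
elim: n => [|n IHn] in F s *; move=> aF.
  have -> : s = 1%g by apply/permP; case.
  by rewrite odd_perm1 mul1r !big_ord0.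
pose f k := odflt k (unlift (s ord0) (s (lift ord0 k))).
have fK k : lift (s ord0) (f k) = s (lift ord0 k).
  rewrite /f; have := neq_lift ord0 k.
  by rewrite -(can_eq (permK s)) => /unlift_some[] ? ? ->.
have f_inj : injective f.
  by move=> k l /(congr1 (lift (s ord0))); rewrite !fK => /perm_inj/lift_inj.
have sE : s = lift_perm ord0 (s ord0) (perm f_inj).
  apply/permP=> i; case: (unliftP ord0 i) => [k ->|->]; last by rewrite lift_perm_id.
  by rewrite lift_perm_lift permE fK.
rewrite big_ord_recl; under eq_bigr => i _ do rewrite -fK -(permE f_inj i).
rewrite (IHn (F \o lift (s ord0))) => [|i k ik]; last first.
  by apply: aF; rewrite (inj_eq lift_inj).
rewrite mulrA (commr_sign (F (s ord0)) (perm f_inj)) -mulrA prod_lift_anti // mulrA; congr (_ * _).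
by rewrite [in RHS]sE odd_lift_perm /= signr_addb signr_odd commr_sign.
Qed.

End Anticommuting.

Section Chevalley.
Variables (K : fieldType) (V : lmodType K) (B : V -> V -> K).
Hypothesis charK0 : [pchar K] =i pred0.

Local Notation cliff_alg := (quot_alg (cliff_rel B)).
Local Notation cliff_in := (cliff_in B).
Local Notation antisym := (antisym B).
Local Notation chevalley := (chevalley B).

Lemma prod_linear_at (I : eqType) (r : seq I) (p : I) c (F F1 F2 : I -> cliff_alg) :
  uniq r -> p \in r -> F p = c *: F1 p + F2 p ->
  (forall i, i != p -> F i = F1 i) -> (forall i, i != p -> F i = F2 i) ->
  \prod_(i <- r) F i = c *: \prod_(i <- r) F1 i + \prod_(i <- r) F2 i.
Proof.
move=> + + Fp F1p F2p; elim: r => // i r IHr /= /andP[ir ur].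
rewrite in_cons !big_cons; have [pi _|pi /= pr] := eqVneq p i; last first.
  have ip : i != p by rewrite eq_sym.
  by rewrite (IHr ur pr) mulrDr -quot_scalerAr -(F1p _ ip) -(F2p _ ip).
rewrite -pi in ir *.
have e (G : I -> cliff_alg) : (forall i, i != p -> F i = G i) ->
    \prod_(j <- r) G j = \prod_(j <- r) F j.
  move=> h; apply: eq_big_seq => j jr; rewrite h //.
  by apply: contraNneq ir => <-.
by rewrite (e F1) // (e F2) // Fp mulrDl -quot_scalerAl.
Qed.

Lemma antisym_multilinear : multilinear antisym.
Proof.
move=> w1 w2 c x y; rewrite /antisym !size_mid.
set n := (_ + _)%N.
have lt_n : (size w1 < n)%N by rewrite /n addnS ltnS leq_addr.
rewrite (scalerA c) [c * _]mulrC -scalerA -scalerDr.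
congr (_ *: _); rewrite scaler_sumr -big_split /=; apply: eq_bigr => s _.
rewrite (scalerA c) [c * _]mulrC -scalerA -scalerDr; congr (_ *: _).
pose p := s^-1%g (Ordinal lt_n).
have sp : s p = Ordinal lt_n by rewrite permKV.
have nsp i : i != p -> s i != size w1 :> nat.
  by rewrite -[size w1]/(val (Ordinal lt_n)) val_eqE -sp (inj_eq perm_inj).
apply: (prod_linear_at (p := p)); rewrite ?index_enum_uniq ?mem_index_enum //.
- by rewrite sp /= !nth_mid linearP.
- by move=> i /nsp h; rewrite (nth_mid_neq _ _ x h).
- by move=> i /nsp h; rewrite (nth_mid_neq _ _ y h).
Qed.

Lemma antisym_alternating : alternating antisym.
Proof.
move=> w1 w2 x; rewrite /antisym size_mid /=; set n := (_ + _)%N.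
have lt_n : (size w1 < n)%N by rewrite /n addnS ltnS leq_addr.
have lt_n' : ((size w1).+1 < n)%N by rewrite /n !addnS !ltnS leq_addr.
set i1 := Ordinal lt_n; set i2 := Ordinal lt_n'.
set w := _ ++ _; have w12 : w`_i1 = w`_i2.
  by rewrite /w /= !nth_cat ltnn subnn ltnNge leqnSn /= subSnn.
set S := \sum_(s : 'S_n) _.
have SN : S = - S.
  rewrite {1}/S (reindex_inj (mulIg (tperm i1 i2))) -sumrN; apply: eq_bigr => s _.
  rewrite odd_permM odd_tperm -val_eqE /= ltn_eqF // signr_addb /= mulrN1 scaleNr.
  congr (- (_ *: _)); apply: eq_bigr => i _; rewrite permM.
  by case: tpermP => [->|->|]//; rewrite w12.
suff -> : S = 0 by rewrite scaler0.
have K2 : (2 : K) != 0 by rewrite ((pcharf0P K).1 charK0).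
by rewrite -[S]scale1r -(mulVf K2) -scalerA mulr2n scalerDl !scale1r {2}SN subrr scaler0.
Qed.

Lemma chevalley_is_linear : linear chevalley.
Proof. exact: ext_lift_is_linear antisym_multilinear antisym_alternating. Qed.

Lemma chevalleyE (w : seq V) : chevalley (\prod_(x <- w) ext_in x) =
  ((size w)`!)%:R^-1 *:
    \sum_(s : 'S_(size w)) (-1) ^+ s *: \prod_(i < size w) cliff_in w`_(s i).
Proof. exact: ext_liftE antisym_multilinear antisym_alternating w. Qed.

Lemma chevalley_orthogonal (w : seq V) :
  (forall i j, (i < j < size w)%N -> B w`_i w`_j = 0) ->
  chevalley (\prod_(x <- w) ext_in x) = \prod_(x <- w) cliff_in x.
Proof.
move=> Bw; rewrite chevalleyE (big_nth 0) big_mkord.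
set n := size w; set P := \prod_(i < n) _.
under eq_bigr => s _.
  rewrite (prod_perm_anti (F := fun i : 'I_n => cliff_in w`_i)) => [|i j ij].
    rewrite -/P; have -> : (-1) ^+ s * P = ((-1) ^+ s : K) *: P.
      by case: (odd_perm s); rewrite ?mulN1r ?mul1r ?scaleN1r ?scale1r.
    rewrite scalerA -signr_addb addbb scale1r.
  over.
  apply/eqP; rewrite -addr_eq0; apply/eqP.
  wlog lt_ij : i j ij / (i < j)%N => [h|]; last first.
    by rewrite cliff_inM Bw ?lt_ij //= mulr0 scale0r.
  move: (ij); rewrite neq_ltn => /orP[|] lt; first exact: h.
  by rewrite addrC; apply: h; rewrite 1?eq_sym.
rewrite sumr_const card_Sn -scaler_nat scalerA mulVf ?scale1r //.
by rewrite ((pcharf0P K).1 charK0) -lt0n fact_gt0.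
Qed.

End Chevalley.

Section EnvelopingAlgebra.
Variables (K : comNzRingType) (V : lmodType K) (br : V -> V -> V).

Definition env_rel : set (tens_alg V) :=
  [set t | exists x y, t = tens_in x * tens_in y - tens_in y * tens_in x - tens_in (br x y)].

Definition env_in (x : V) : quot_alg env_rel := quot_pi env_rel (tens_in x).

Lemma env_in_is_linear : linear env_in.
Proof. by move=> c x y; rewrite /env_in -quot_piZ quot_alg_mapE -quot_piD linearP. Qed.
HB.instance Definition _ :=
  GRing.isLinear.Build K V (quot_alg env_rel) *:%R env_in env_in_is_linear.

Lemma env_inM x y : env_in x * env_in y - env_in y * env_in x = env_in (br x y).
Proof.
rewrite -!quot_piM -raddfB; apply/quot_piP; apply: GenIdeal_mem.
by exists x, y; rewrite /tens_in -!quot_piM.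
Qed.

End EnvelopingAlgebra.

Notation cliff_alg B := (quot_alg (cliff_rel B)).
Notation env_alg br := (quot_alg (env_rel br)).

(* The multiplicative monoid of the product ring A * B. *)
Definition mul_pair (A B : pzRingType) := (A * B)%type.
Section MulPair.
Variables A B : pzRingType.
Definition mul_pair_op (p q : mul_pair A B) : mul_pair A B := (p.1 * q.1, p.2 * q.2).
Lemma mul_pairA : associative mul_pair_op.
Proof. by move=> p q r; rewrite /mul_pair_op !mulrA. Qed.
Lemma mul_pair1p : left_id (1, 1) mul_pair_op.
Proof. by case=> a b; rewrite /mul_pair_op !mul1r. Qed.
Lemma mul_pairp1 : right_id (1, 1) mul_pair_op.
Proof. by case=> a b; rewrite /mul_pair_op !mulr1. Qed.
HB.instance Definition _ := Choice.on (mul_pair A B).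
HB.instance Definition _ := isMonoid.Build (mul_pair A B) mul_pairA mul_pair1p mul_pairp1.
End MulPair.

(* The tensor product A (x) B of algebras: the free module on A * B modulo
   bilinearity, with the product (a (x) u) (b (x) w) = ab (x) uw. The span of
   the bilinearity relations is already a two-sided ideal of K[A * B]. *)
Section TensorProduct.
Variables (K : comNzRingType) (A B : pzAlgType K).

Definition pure (a : A) (b : B) : monoid_alg K (mul_pair A B) :=
  mon K ((a, b) : mul_pair A B).

Definition bilin_rel : set (monoid_alg K (mul_pair A B)) :=
  [set t | (exists c a a' b,
              t = pure (alg_map c * a + a') b - (c *: pure a b + pure a' b)) \/
           (exists c a b b',
              t = pure a (alg_map c * b + b') - (c *: pure a b + pure a b'))].

Definition tensor (a : A) (b : B) : quot_alg bilin_rel := quot_pi bilin_rel (pure a b).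

Lemma tensorM a a' b b' : tensor a b * tensor a' b' = tensor (a * a') (b * b').
Proof. by rewrite -quot_piM monM. Qed.

Lemma tensor11 : tensor 1 1 = 1. Proof. by []. Qed.

Lemma tensorDl c a a' b :
  tensor (alg_map c * a + a') b = c *: tensor a b + tensor a' b.
Proof.
rewrite -quot_piZ mon_alg_mapE -quot_piD; apply/quot_piP; apply: GenIdeal_mem.
by left; exists c, a, a', b.
Qed.

Lemma tensorDr c a b b' :
  tensor a (alg_map c * b + b') = c *: tensor a b + tensor a b'.
Proof.
rewrite -quot_piZ mon_alg_mapE -quot_piD; apply/quot_piP; apply: GenIdeal_mem.
by right; exists c, a, b, b'.
Qed.

End TensorProduct.

Notation tensor_alg A B := (quot_alg (@bilin_rel _ A B)).

Section DiracOperator.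
Variables (K : fieldType) (V : lmodType K) (br : V -> V -> V) (B : V -> V -> K).

(* The element of degree 3 of the exterior algebra representing the trilinear
   form - B(x, [y, z]) / 2. It exists and is unique when B is non-degenerate
   and invariant; 0 is a junk value. *)
Definition fund_form : ext_alg V :=
  xget 0 [set v | ext_degree 3 v /\
    forall x y z, ext_form B v (ext_in x * ext_in y * ext_in z) =
                  - 2^-1 * B x (br y z)].

Definition fund_cliff : cliff_alg B := chevalley B fund_form.

Definition casimir (X : seq V) : env_alg br := \sum_(x <- X) env_in br x ^+ 2.

Definition dirac (X : seq V) : tensor_alg (env_alg br) (cliff_alg B) :=
  \sum_(x <- X) tensor (env_in br x) (cliff_in B x) + tensor 1 fund_cliff.

End DiracOperator.

(* Main.v *)
Require Import Defs.
From HB Require Import structures.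
From mathcomp Require Import all_boot all_order all_algebra.
From mathcomp Require Import ring.
From mathcomp Require Import complex boolp classical_sets reals.

Set Implicit Arguments.
Unset Strict Implicit.
Unset Printing Implicit Defensive.

Import GRing.Theory Num.Theory Num.Def.
Local Open Scope ring_scope.

(** Fix an orthonormal basis X of the Lie algebra, let f i j k = B(X_i, [X_j, X_k]) be
its structure constants, totally antisymmetric by invariance, and let e_i be the
generators of the Clifford algebra. All computations take place in this basis.

- An element of degree 3 is determined by its pairings with the products of three
  basis vectors, so the fundamental form is -1/12 sum f_ijk X_i /\ X_j /\ X_k
  ([fund_formE]); its terms with a repeated index vanish, so its image in the
  Clifford algebra is v = -1/12 w with w = sum f_ijk e_i e_j e_k ([fund_cliffE]).

- Put b_l = sum f_lij e_i e_j. Moving e_l through w gives e_l w + w e_l = 6 b_l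
  ([anticomm_cubic]), and w = sum e_l b_l. Since b_l commutes with w
  ([comm_cubic_quadr]), evaluating w w in the two ways
  sum w e_l b_l = sum e_l w b_l yields 2 w^2 = 6 sum b_l^2.

- The sum of the b_l^2 is sum R_jklm e_j e_k e_l e_m, where
  R_jklm = B([X_j, X_k], [X_l, X_m]) has the symmetries of a Riemann curvature tensor:
  the Jacobi identity is its first Bianchi identity. The computation behind the
  Lichnerowicz formula then applies: the Bianchi identity reduces
  sum R_jklm e_j e_k e_l to the Ricci contraction ([curv_cubicE]), whose symmetry
  turns the quartic sum into a scalar ([curv_quartic]). Hence v^2 is a scalar
  ([sqr_fund_cliff]).

- In the square of sum X_i (x) e_i + 1 (x) v, the linear part squares to
  Omega (x) 1 + 1/2 sum_k X_k (x) b_k: symmetrising in (i, j) trades X_i X_j for a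
  bracket ([sqr_linear_part]). The cross terms are sum X_k (x) (e_k v + v e_k), that is
  -1/2 sum X_k (x) b_k, and cancel this remainder ([sqr_dirac]).

The scalar must exist before any basis is given; it is obtained from an orthonormal
basis, which exists because complex numbers have square roots
([orthonormal_basis_exists]). *)

(** * Finite sums *)

Lemma sum_delta {K : pzRingType} {W : lmodType K} {I : finType} (F : I -> W) j :
  \sum_i (i == j)%:R *: F i = F j.
Proof.
rewrite (bigD1 j) //= eqxx scale1r big1 ?addr0 // => i /negPf ->.
by rewrite scale0r.
Qed.

Lemma sum_rot {W : nmodType} {I : finType} (F : I -> I -> I -> W) :
  \sum_i \sum_j \sum_k F i j k = \sum_k \sum_i \sum_j F i j k.
Proof. by rewrite [RHS]exchange_big; apply: eq_bigr => i _; rewrite exchange_big. Qed.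

Lemma sum_inward {W : nmodType} {I : finType} (F : I -> I -> I -> I -> W) :
  \sum_p \sum_i \sum_j \sum_k F p i j k = \sum_i \sum_j \sum_k \sum_p F p i j k.
Proof.
by rewrite exchange_big; apply: eq_bigr => i _; rewrite sum_rot sum_rot.
Qed.

Lemma linear_comb {K : pzRingType} {V W : lmodType K} {I : finType} (h : V -> W)
    (hl : linear h) (a : I -> K) (X : I -> V) :
  h (\sum_i a i *: X i) = \sum_i a i *: h (X i).
Proof.
pose H : {linear V -> W} := HB.pack h (GRing.isLinear.Build K V W *:%R h hl).
rewrite -[h]/(H : V -> W) linear_sum; apply: eq_bigr => i _; exact: linearZ.
Qed.

Lemma natK_neq0 (K : fieldType) (charK0 : [pchar K] =i pred0) m : (m.+1%:R : K) != 0.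
Proof. by rewrite ((pcharf0P K).1 charK0). Qed.

(** * The cubic element of a Clifford family *)

Section CubicElement.
Variables (K : fieldType) (A0 : pzAlgType K) (S : set A0) (I : finType).
Variables (e : I -> quot_alg S) (f : I -> I -> I -> K).
Hypothesis charK0 : [pchar K] =i pred0.
Hypothesis eC : forall i j, e i * e j + e j * e i = (2 * (i == j)%:R) *: (1 : quot_alg S).
Hypothesis f_rot : forall i j k, f i j k = f j k i.
Hypothesis f_swap : forall i j k, f i k j = - f i j k.

(** For the structure constants in an orthonormal basis this is the Gram matrix
B([X_j, X_k], [X_l, X_m]) of the brackets (see [curv_str]); it plays the role of a
curvature tensor, and [ric] that of its Ricci contraction. *)
Definition curv j k l m := \sum_p f p j k * f p l m.
Hypothesis bianchi : forall j k l m, curv j k l m + curv k l j m + curv l j k m = 0.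

Definition ric k m := \sum_j curv j k j m.

Definition cubic := \sum_i \sum_j \sum_k f i j k *: (e i * e j * e k).
Definition quadr l := \sum_i \sum_j f l i j *: (e i * e j).

Lemma scale_natI m (x y : quot_alg S) :
  (m.+1%:R : K) *: x = m.+1%:R *: y -> x = y.
Proof. by move/(congr1 (GRing.scale m.+1%:R^-1)); rewrite !scalerA mulVf ?(natK_neq0 charK0) // !scale1r. Qed.

Lemma anticommE i j : e i * e j = (2 * (i == j)%:R) *: (1 : quot_alg S) - e j * e i.
Proof. by rewrite -eC addrK. Qed.

Lemma curv_swapl j k l m : curv k j l m = - curv j k l m.
Proof. by rewrite -sumrN; apply: eq_bigr => p _; rewrite f_swap mulNr. Qed.

Lemma curv_pair j k l m : curv j k l m = curv l m j k.
Proof. by apply: eq_bigr => p _; rewrite mulrC. Qed.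

Lemma ric_sym k m : ric k m = ric m k.
Proof. by apply: eq_bigr => j _; rewrite curv_pair. Qed.

Lemma ricNl k m : \sum_j curv k j j m = - ric k m.
Proof. by rewrite -sumrN; apply: eq_bigr => j _; rewrite curv_swapl. Qed.

Definition curv_cubic m := \sum_j \sum_k \sum_l curv j k l m *: (e j * e k * e l).
Definition ric_vec m := \sum_k ric k m *: e k.

Lemma sum_ricl m : \sum_j \sum_k curv j k j m *: e k = ric_vec m.
Proof. by rewrite exchange_big /=; apply: eq_bigr => k _; rewrite scaler_suml. Qed.

Lemma sum_ricr m : \sum_j \sum_k curv j k k m *: e j = - ric_vec m.
Proof. by rewrite -sumrN; apply: eq_bigr => j _; rewrite -scaleNr -ricNl scaler_suml. Qed.

(** The next three lemmas reorder the letters of [curv_cubic]; each exchange of two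
letters costs one contraction of the curvature, which is a multiple of [ric_vec]. *)
Lemma curv_cubic_swapr m :
  \sum_j \sum_k \sum_l curv j k l m *: (e j * e l * e k) = - (2 *: ric_vec m) - curv_cubic m.
Proof.
rewrite -scalerN -sum_ricr scaler_sumr -sumrB; apply: eq_bigr => j _.
rewrite scaler_sumr -sumrB; apply: eq_bigr => k _.
rewrite -(sum_delta (fun l => 2 *: (curv j k l m *: e j)) k) -sumrB; apply: eq_bigr => l _.
rewrite -mulrA anticommE mulrBr -quot_scalerAr mulr1 mulrA scalerBr !scalerA.
by congr (_ *: _ - _); rewrite mulrC -mulrA mulrCA mulrA.
Qed.

Lemma curv_cubic_rotl m :
  \sum_j \sum_k \sum_l curv j k l m *: (e l * e j * e k) = curv_cubic m + 4 *: ric_vec m.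
Proof.
have -> : curv_cubic m + 4 *: ric_vec m =
    2 *: ric_vec m - (- (2 *: ric_vec m) - curv_cubic m).
  by rewrite opprD !opprK addrA -scalerDl -natrD addrC.
rewrite -curv_cubic_swapr -sum_ricl scaler_sumr -sumrB; apply: eq_bigr => j _.
rewrite scaler_sumr -sumrB; apply: eq_bigr => k _.
rewrite -(sum_delta (fun l => 2 *: (curv j k l m *: e k)) j) -sumrB; apply: eq_bigr => l _.
rewrite anticommE mulrBl -quot_scalerAl mul1r scalerBr !scalerA.
by congr (_ *: _ - _); rewrite mulrC -mulrA mulrCA mulrA.
Qed.

Lemma curv_cubic_rotr m :
  \sum_j \sum_k \sum_l curv j k l m *: (e k * e l * e j) = curv_cubic m + 2 *: ric_vec m.
Proof.
transitivity (- (- (2 *: ric_vec m) - curv_cubic m)); last first.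
  by rewrite opprD !opprK addrC.
rewrite -curv_cubic_swapr exchange_big -sumrN; apply: eq_bigr => j _.
rewrite -sumrN; apply: eq_bigr => k _; rewrite -sumrN; apply: eq_bigr => l _.
by rewrite curv_swapl scaleNr.
Qed.

(** Adding up the three cyclic reorderings of the letters amounts to permuting the
indices of the curvature cyclically, which gives 0 by the Bianchi identity; the
corrections are 4 and 2 times the Ricci term, so three times the left-hand side is
-6 times the Ricci term. *)
Lemma curv_cubicE m : curv_cubic m = - (2 *: ric_vec m).
Proof.
apply: (@scale_natI 2); apply/eqP; rewrite scalerN scalerA -natrM -addr_eq0; apply/eqP.
transitivity (curv_cubic m + (curv_cubic m + 4 *: ric_vec m) + (curv_cubic m + 2 *: ric_vec m)).
  rewrite [RHS](AC (1*2*2) ((1*2*4)*(3*5))) /= -scalerDl -natrD; congr (_ + _).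
  by rewrite scaler_nat -mulr2n -mulrSr.
rewrite -curv_cubic_rotl -curv_cubic_rotr.
have -> : \sum_j \sum_k \sum_l curv j k l m *: (e l * e j * e k) =
    \sum_j \sum_k \sum_l curv k l j m *: (e j * e k * e l).
  by rewrite sum_rot sum_rot.
have -> : \sum_j \sum_k \sum_l curv j k l m *: (e k * e l * e j) =
    \sum_j \sum_k \sum_l curv l j k m *: (e j * e k * e l).
  by rewrite [RHS]sum_rot.
rewrite /curv_cubic -!big_split big1 //= => j _; rewrite -!big_split big1 //= => k _.
by rewrite -!big_split big1 //= => l _; rewrite -!scalerDl bianchi scale0r.
Qed.

(** By [curv_cubicE] only a quadratic expression with symmetric coefficients is left,
and symmetrising e_k e_m leaves only its trace. *)
Lemma curv_quartic :
  \sum_m curv_cubic m * e m = - (2 * \sum_m ric m m) *: (1 : quot_alg S).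
Proof.
pose Q := \sum_k \sum_m ric k m *: (e k * e m).
have -> : \sum_m curv_cubic m * e m = - (2 *: Q).
  rewrite /Q exchange_big scaler_sumr -sumrN; apply: eq_bigr => m _.
  rewrite curv_cubicE mulNr -quot_scalerAl mulr_suml; congr (- (_ *: _)).
  by apply: eq_bigr => k _; rewrite -quot_scalerAl.
rewrite scaleNr; congr (- _).
transitivity (Q + Q); first by rewrite scaler_nat.
rewrite {2}/Q exchange_big -big_split mulr_sumr scaler_suml; apply: eq_bigr => k _.
rewrite -big_split -(sum_delta (fun m => (2 * ric k m) *: (1 : quot_alg S)) k) /=.
apply: eq_bigr => m _; rewrite (ric_sym m) -scalerDr eC !scalerA eq_sym.
by congr (_ *: _); rewrite mulrCA mulrA mulrC.
Qed.

Lemma sum_sqr_quadr : \sum_i quadr i * quadr i = \sum_m curv_cubic m * e m.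
Proof.
transitivity (\sum_j \sum_k \sum_l \sum_m curv j k l m *: (e j * e k * (e l * e m))).
  under eq_bigr => i _.
    rewrite mulr_suml; under eq_bigr => j _.
      rewrite mulr_suml; under eq_bigr => k _.
        rewrite mulr_sumr; under eq_bigr => l _.
          rewrite mulr_sumr; under eq_bigr => m _.
            rewrite -quot_scalerAl -quot_scalerAr scalerA.
          over.
        over.
      over.
    over.
  over.
  rewrite exchange_big; apply: eq_bigr => j _; rewrite exchange_big; apply: eq_bigr => k _.
  rewrite exchange_big; apply: eq_bigr => l _; rewrite exchange_big; apply: eq_bigr => m _.
  by rewrite scaler_suml.
under [RHS]eq_bigr => m _.
  rewrite mulr_suml; under eq_bigr => j _.
    rewrite mulr_suml; under eq_bigr => k _.
      rewrite mulr_suml; under eq_bigr => l _ do rewrite -quot_scalerAl -mulrA.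
    over.
  over.
over.
rewrite [RHS]exchange_big; apply: eq_bigr => j _; rewrite [RHS]exchange_big.
by apply: eq_bigr => k _; rewrite [RHS]exchange_big.
Qed.

Lemma cubicE : cubic = \sum_l e l * quadr l.
Proof.
apply: eq_bigr => l _; rewrite mulr_sumr; apply: eq_bigr => i _; rewrite mulr_sumr.
by apply: eq_bigr => j _; rewrite -quot_scalerAr mulrA.
Qed.

Lemma anticomm_prod3 l i j k : e l * (e i * e j * e k) + e i * e j * e k * e l =
  2 *: ((i == l)%:R *: (e j * e k) - (j == l)%:R *: (e i * e k) + (k == l)%:R *: (e i * e j)).
Proof.
rewrite scalerDr scalerBr !scalerA !mulrA.
have E i' : e l * e i' + e i' * e l = (2 * (i' == l)%:R) *: (1 : quot_alg S).
  by rewrite eC eq_sym.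
transitivity ((e l * e i + e i * e l) * e j * e k - e i * (e l * e j + e j * e l) * e k
   + e i * e j * (e l * e k + e k * e l)).
  rewrite !(mulrDl, mulrDr) !mulrA opprD.
  by rewrite [RHS](AC (2*2*2) ((1*6)*(2*3)*(4*5))) /= subrr addNr !addr0.
by rewrite !E -!quot_scalerAl -!quot_scalerAr mul1r !mulr1 -quot_scalerAl.
Qed.

(** The three contractions of e_l with the letters of w contribute equally, because f is
invariant under rotation and changes sign with a swap. *)
Lemma anticomm_cubic l : e l * cubic + cubic * e l = 6 *: quadr l.
Proof.
have -> : e l * cubic + cubic * e l = 2 *: \sum_i \sum_j \sum_k f i j k *:
    ((i == l)%:R *: (e j * e k) - (j == l)%:R *: (e i * e k) + (k == l)%:R *: (e i * e j)).
  rewrite mulr_sumr mulr_suml -big_split scaler_sumr; apply: eq_bigr => i _ /=.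
  rewrite mulr_sumr mulr_suml -big_split scaler_sumr; apply: eq_bigr => j _ /=.
  rewrite mulr_sumr mulr_suml -big_split scaler_sumr; apply: eq_bigr => k _ /=.
  rewrite -quot_scalerAr -quot_scalerAl -scalerDr anticomm_prod3 !scalerA.
  by congr (_ *: _); rewrite mulrC.
rewrite -[6]/((2 * 3)%:R) natrM -scalerA; congr (_ *: _).
transitivity (quadr l + quadr l + quadr l); last first.
  by rewrite scaler_nat -mulr2n -mulrSr.
have s (a b : K) (x : quot_alg S) : a *: (b *: x) = b *: (a *: x).
  by rewrite !scalerA mulrC.
transitivity (\sum_i \sum_j \sum_k (i == l)%:R *: (f i j k *: (e j * e k))
  - \sum_i \sum_j \sum_k (j == l)%:R *: (f i j k *: (e i * e k))
  + \sum_i \sum_j \sum_k (k == l)%:R *: (f i j k *: (e i * e j))).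
  rewrite -sumrB -big_split; apply: eq_bigr => i _ /=.
  rewrite -sumrB -big_split; apply: eq_bigr => j _ /=.
  rewrite -sumrB -big_split; apply: eq_bigr => k _ /=.
  by rewrite scalerDr scalerBr !(s (f i j k)).
congr (_ + _ + _).
- rewrite -[RHS](sum_delta quadr); apply: eq_bigr => i _.
  rewrite scaler_sumr; apply: eq_bigr => j _; rewrite scaler_sumr.
  by apply: eq_bigr => k _.
- rewrite -sumrN; apply: eq_bigr => i _.
  under eq_bigr => j _ do rewrite -scaler_sumr.
  by rewrite sum_delta -sumrN; apply: eq_bigr => k _; rewrite -scaleNr f_rot -f_swap -f_rot f_swap.
- apply: eq_bigr => i _; apply: eq_bigr => j _.
  by rewrite sum_delta -f_rot.
Qed.

(** The commutator of w with e_j e_k is 6 (b_j e_k - e_j b_k), by [anticomm_cubic]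
twice. Contracted with f this gives two reorderings of [curv_cubic], whose Ricci
terms -2, -2 and 4 cancel. *)
Lemma comm_cubic_quadr i : cubic * quadr i = quadr i * cubic.
Proof.
apply/eqP; rewrite -subr_eq0; apply/eqP.
have D j k : cubic * (e j * e k) - e j * e k * cubic = 6 *: (quadr j * e k - e j * quadr k).
  rewrite scalerBr quot_scalerAl quot_scalerAr -!anticomm_cubic mulrDl mulrDr opprD !mulrA.
  by rewrite [RHS](AC (2*2) ((1*4)*(2*3))) /= subrr add0r.
have -> : cubic * quadr i - quadr i * cubic =
    6 *: \sum_j \sum_k f i j k *: (quadr j * e k - e j * quadr k).
  rewrite mulr_sumr mulr_suml -sumrB scaler_sumr; apply: eq_bigr => j _ /=.
  rewrite mulr_sumr mulr_suml -sumrB scaler_sumr; apply: eq_bigr => k _ /=.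
  by rewrite -quot_scalerAr -quot_scalerAl -scalerBr D !scalerA mulrC.
have -> : \sum_j \sum_k f i j k *: (quadr j * e k - e j * quadr k) =
    curv_cubic i + (curv_cubic i + 4 *: ric_vec i).
  rewrite -curv_cubic_rotl.
  transitivity (\sum_j \sum_k f i j k *: (quadr j * e k)
      - \sum_j \sum_k f i j k *: (e j * quadr k)).
    rewrite -sumrB; apply: eq_bigr => j _; rewrite -sumrB; apply: eq_bigr => k _.
    exact: scalerBr.
  congr (_ + _).
    transitivity (\sum_j \sum_k \sum_l \sum_m (f j k i * f j l m) *: (e l * e m * e k)).
      apply: eq_bigr => j _; apply: eq_bigr => k _.
      rewrite mulr_suml scaler_sumr; apply: eq_bigr => l _.
      rewrite mulr_suml scaler_sumr; apply: eq_bigr => m _.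
      by rewrite -quot_scalerAl scalerA (f_rot i).
    rewrite sum_inward [RHS]sum_rot.
    apply: eq_bigr => k _; apply: eq_bigr => l _; apply: eq_bigr => m _.
    by rewrite curv_pair scaler_suml.
  rewrite [in RHS]sum_rot -sumrN; apply: eq_bigr => j _.
  transitivity (\sum_k \sum_l \sum_m (f k l m * f k j i) *: (e j * e l * e m)).
    rewrite -sumrN; apply: eq_bigr => k _.
    rewrite mulr_sumr scaler_sumr -sumrN; apply: eq_bigr => l _.
    rewrite mulr_sumr scaler_sumr -sumrN; apply: eq_bigr => m _.
    by rewrite -quot_scalerAr scalerA mulrA -scaleNr [f k j i]f_swap mulrN (f_rot i) (f_rot j) mulrC.
  rewrite exchange_big; apply: eq_bigr => l _; rewrite exchange_big.
  by apply: eq_bigr => m _; rewrite scaler_suml.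
by rewrite curv_cubicE addrA -opprD -scalerDl -natrD addNr scaler0.
Qed.

(** Expand one factor of w w as the sum of the e_i b_i, once on the right and once,
using that b_i commutes with w, on the left: the two results add up to the sum of
(w e_i + e_i w) b_i, that is, to 6 times the sum of the b_i^2. *)
Lemma sqr_cubic : cubic * cubic = - (6 * \sum_m ric m m) *: (1 : quot_alg S).
Proof.
apply: (@scale_natI 1).
transitivity (6 *: \sum_i quadr i * quadr i); last first.
  by rewrite sum_sqr_quadr curv_quartic !scalerA -!mulrN !mulrA -!natrM.
have E1 : cubic * cubic = \sum_i cubic * e i * quadr i.
  by rewrite {2}cubicE mulr_sumr; apply: eq_bigr => i _; rewrite mulrA.
have E2 : cubic * cubic = \sum_i e i * cubic * quadr i.
  rewrite {1}cubicE mulr_suml; apply: eq_bigr => i _.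
  by rewrite -!mulrA comm_cubic_quadr.
rewrite scaler_nat mulr2n {1}E2 E1 -big_split scaler_sumr; apply: eq_bigr => i _.
by rewrite /= -mulrDl anticomm_cubic quot_scalerAl.
Qed.

End CubicElement.

(** * The square of a Dirac-type operator *)

Section TensorBilinear.
Variables (K : comNzRingType) (A B : pzAlgType K) (S : set A) (T : set B).
Local Notation tens := (@tensor K (quot_alg S) (quot_alg T)).

Lemma tensor_is_bilinear : bilinear_for *:%R *:%R tens.
Proof.
split=> [b|a] c x y.
  by rewrite -[c *: x]quot_alg_mapE tensorDl.
by rewrite -[c *: x]quot_alg_mapE tensorDr.
Qed.
HB.instance Definition _ :=
  bilinear_isBilinear.Build K (quot_alg S) (quot_alg T)
    (tensor_alg (quot_alg S) (quot_alg T)) *:%R *:%R tens tensor_is_bilinear.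
End TensorBilinear.

Lemma cancel_middle {W : zmodType} (a q c1 c2 d : W) :
  c1 + c2 = - q -> (a + q) + c1 + (c2 + d) = a + d.
Proof. by move=> h; rewrite addrA -(addrA _ c1) h addrK. Qed.

Section DiracSquare.
Variables (K : fieldType) (A1 A2 : pzAlgType K) (S1 : set A1) (S2 : set A2) (I : finType).
Variables (E : I -> quot_alg S1) (e : I -> quot_alg S2) (f : I -> I -> I -> K).
Hypothesis charK0 : [pchar K] =i pred0.
Hypothesis E_bracket : forall i j, E i * E j - E j * E i = \sum_k f k i j *: E k.
Hypothesis eC : forall i j, e i * e j + e j * e i = (2 * (i == j)%:R) *: (1 : quot_alg S2).
Local Notation tens := (@tensor K (quot_alg S1) (quot_alg S2)).

(** Twice the square is the sum over (i, j) of E_i E_j (x) e_i e_j and its transpose.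
Replacing e_j e_i by 2 delta_ij - e_i e_j leaves the bracket of E_i and E_j on the
first factor, plus the diagonal terms. *)
Lemma sqr_linear_part :
  (\sum_i tens (E i) (e i)) * (\sum_i tens (E i) (e i)) =
  tens (\sum_i E i ^+ 2) 1 + 2^-1 *: \sum_i tens (E i) (quadr e f i).
Proof.
have LL : (\sum_i tens (E i) (e i)) * (\sum_i tens (E i) (e i)) =
    \sum_i \sum_j tens (E i * E j) (e i * e j).
  rewrite mulr_suml; apply: eq_bigr => i _; rewrite mulr_sumr.
  by apply: eq_bigr => j _; rewrite tensorM.
apply: (@scale_natI _ _ _ charK0 1).
rewrite scalerDr scalerA divff ?(natK_neq0 charK0) // scale1r scaler_nat mulr2n.
rewrite LL {1}exchange_big -big_split /=.
have step i j : tens (E j * E i) (e j * e i) + tens (E i * E j) (e i * e j) =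
   (i == j)%:R *: (2 *: tens (E j * E i) 1) + \sum_k f k i j *: tens (E k) (e i * e j).
  have -> : e j * e i = (2 * (i == j)%:R) *: (1 : quot_alg S2) - e i * e j.
    by rewrite -eC [_ + e j * _]addrC addrK.
  rewrite linearBr linearZr_LR scalerA mulrC -addrA; congr (_ *: _ + _).
  rewrite addrC -linearBl /= E_bracket linear_sumlz.
  by apply: eq_bigr => k _; rewrite linearZl_LR.
under eq_bigr => i _.
  rewrite -big_split /=; under eq_bigr => j _ do rewrite step.
  rewrite big_split /=.
over.
rewrite big_split /=; congr (_ + _).
  rewrite linear_sumlz scaler_sumr exchange_big; apply: eq_bigr => j _.
  by rewrite sum_delta expr2.
rewrite sum_rot; apply: eq_bigr => k _; rewrite linear_sumr; apply: eq_bigr => i _.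
by rewrite linear_sumr; apply: eq_bigr => j _; rewrite linearZr_LR.
Qed.

Lemma sqr_dirac v c : v * v = c *: (1 : quot_alg S2) ->
  (forall i, e i * v + v * e i = - 2^-1 *: quadr e f i) ->
  (\sum_i tens (E i) (e i) + tens 1 v) * (\sum_i tens (E i) (e i) + tens 1 v) =
  tens (\sum_i E i ^+ 2) 1 + c *: tens 1 1.
Proof.
move=> vv ev.
have crossr : (\sum_i tens (E i) (e i)) * tens 1 v = \sum_i tens (E i) (e i * v).
  by rewrite mulr_suml; apply: eq_bigr => i _; rewrite tensorM mulr1.
have crossl : tens 1 v * (\sum_i tens (E i) (e i)) = \sum_i tens (E i) (v * e i).
  by rewrite mulr_sumr; apply: eq_bigr => i _; rewrite tensorM mul1r.
have cross : \sum_i tens (E i) (e i * v) + \sum_i tens (E i) (v * e i) =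
    - (2^-1 *: \sum_i tens (E i) (quadr e f i)).
  rewrite -big_split scaler_sumr -sumrN; apply: eq_bigr => i _ /=.
  by rewrite -linearDr /= ev linearZr_LR /= scaleNr.
have last : tens 1 v * tens 1 v = c *: tens 1 1.
  by rewrite tensorM mulr1 vv linearZr_LR.
rewrite mulrDl !mulrDr sqr_linear_part crossr crossl last.
exact: cancel_middle.
Qed.
End DiracSquare.

(** * The fundamental form in an orthonormal basis *)

Section QuadraticLie.
Variables (K : fieldType) (V : lmodType K) (br : {bilinear V -> V -> V}) (B : {symmetric V}).
Hypothesis charK0 : [pchar K] =i pred0.
Hypothesis br_alternating : forall x, br x x = 0.
Hypothesis br_jacobi : forall x y z, br x (br y z) + br y (br z x) + br z (br x y) = 0.
Hypothesis B_invariant : forall x y z, B (br x y) z + B y (br x z) = 0.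

Lemma form_sym x y : B x y = B y x.
Proof. by rewrite hermC expr0 mul1r. Qed.

Lemma form_linear x : linear (B x : V -> K^o).
Proof. by move=> c y z; rewrite linearPr. Qed.

Lemma form_linearl x : linear (B^~ x : V -> K^o).
Proof. by move=> c y z; rewrite linearPl. Qed.

Lemma br_anti x y : br y x = - br x y.
Proof.
apply/eqP; rewrite -addr_eq0; apply/eqP.
have := br_alternating (x + y).
by rewrite linearDl !linearDr !br_alternating addr0 add0r addrC.
Qed.

Lemma form_br_rot x y z : B x (br y z) = B y (br z x).
Proof.
rewrite (br_anti z y) linearNr /= [RHS]form_sym.
by apply/eqP; rewrite eq_sym -addr_eq0 B_invariant.
Qed.

Lemma form_br_swap x y z : B x (br z y) = - B x (br y z).
Proof. by rewrite br_anti linearNr. Qed.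

(** By invariance each term is the pairing of t with a double bracket of x, y and z,
so that this is the Jacobi identity. *)
Lemma form_br_bianchi x y z t :
  B (br x y) (br z t) + B (br y z) (br x t) + B (br z x) (br y t) = 0.
Proof.
have E u v : B u (br v t) = B t (br u v) by rewrite form_br_rot form_br_rot.
rewrite !E -!linearDr /= (br_anti z) (br_anti x (br y z)) (br_anti y (br z x)).
rewrite -!opprD linearNr /=.
rewrite [X in B t X](_ : _ = 0) ?linear0r ?oppr0 //.
Qed.

Lemma ext_anti x y : ext_in y * ext_in x = - (ext_in x * ext_in y) :> ext_alg V.
Proof.
have sq z : ext_in z * ext_in z = 0 :> ext_alg V.
  by rewrite -quot_piM; apply: quot_pi0; exists z.
apply/eqP; rewrite -addr_eq0; apply/eqP.
by have := sq (x + y); rewrite linearD mulrDl !mulrDr !sq addr0 add0r addrC.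
Qed.

Lemma ext_form3 x1 x2 x3 y1 y2 y3 :
  ext_form B (ext_in x1 * ext_in x2 * ext_in x3) (ext_in y1 * ext_in y2 * ext_in y3) =
  B x1 y1 * B x2 y2 * B x3 y3 - B x1 y1 * B x2 y3 * B x3 y2
  - B x1 y2 * B x2 y1 * B x3 y3 + B x1 y2 * B x2 y3 * B x3 y1
  + B x1 y3 * B x2 y1 * B x3 y2 - B x1 y3 * B x2 y2 * B x3 y1.
Proof.
have := ext_formE form_linear form_sym [:: x1; x2; x3] [:: y1; y2; y3].
rewrite !big_cons !big_nil !mulr1 !mulrA /= => ->.
rewrite (expand_det_row _ ord0) !big_ord_recl big_ord0 /cofactor.
rewrite !(expand_det_row _ ord0) !big_ord_recl !big_ord0 /cofactor !det_mx11 !mxE /=.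
ring.
Qed.

Variables (n : nat) (X : 'I_n -> V).
Hypothesis X_orthonormal : forall i j, B (X i) (X j) = (i == j)%:R.
Hypothesis X_span : forall x, x = \sum_i B x (X i) *: X i.

Lemma trilinear_expand {W : lmodType K} (T : V -> V -> V -> W) :
  (forall y z, linear (fun x => T x y z)) -> (forall x z, linear (fun y => T x y z)) ->
  (forall x y, linear (fun z => T x y z)) -> forall x y z,
  \sum_i \sum_j \sum_k (B (X i) x * B (X j) y * B (X k) z) *: T (X i) (X j) (X k) = T x y z.
Proof.
move=> T1 T2 T3 x y z; rewrite [in RHS](X_span x) (linear_comb (T1 y z)).
apply: eq_bigr => i _; rewrite [in RHS](X_span y) (linear_comb (T2 _ z)) scaler_sumr.
apply: eq_bigr => j _; rewrite [in RHS](X_span z) (linear_comb (T3 _ _)) !scaler_sumr.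
by apply: eq_bigr => k _; rewrite !scalerA !(form_sym (X _)).
Qed.

Definition str_const i j k : K := B (X i) (br (X j) (X k)).

Definition ext3 x y z : ext_alg V := ext_in x * ext_in y * ext_in z.

Lemma ext3_linear1 y z : linear (fun x => ext3 x y z).
Proof. by move=> c x x'; rewrite /ext3 linearP !mulrDl -!quot_scalerAl. Qed.

Lemma ext3_linear2 x z : linear (fun y => ext3 x y z).
Proof. by move=> c y y'; rewrite /ext3 linearP mulrDr mulrDl -quot_scalerAr -quot_scalerAl. Qed.

Lemma ext3_linear3 x y : linear (fun z => ext3 x y z).
Proof. by move=> c z z'; rewrite /ext3 linearP mulrDr -quot_scalerAr. Qed.

Lemma ext3_swap12 x y z : ext3 y x z = - ext3 x y z.
Proof. by rewrite /ext3 (ext_anti x y) mulNr. Qed.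

Lemma ext3_swap23 x y z : ext3 x z y = - ext3 x y z.
Proof. by rewrite /ext3 -!mulrA (ext_anti y z) mulrN. Qed.

(** The expression of the fundamental form in the basis (see [fund_formE]). *)
Definition fund3 : ext_alg V :=
  - 12^-1 *: \sum_i \sum_j \sum_k str_const i j k *: ext3 (X i) (X j) (X k).

Lemma sum3_add {W : zmodType} (F G : 'I_n -> 'I_n -> 'I_n -> W) :
  \sum_i \sum_j \sum_k (F i j k + G i j k) =
  \sum_i \sum_j \sum_k F i j k + \sum_i \sum_j \sum_k G i j k.
Proof.
rewrite -big_split; apply: eq_bigr => i _; rewrite -big_split; apply: eq_bigr => j _.
by rewrite -big_split.
Qed.

Lemma sum3_opp {W : zmodType} (F : 'I_n -> 'I_n -> 'I_n -> W) :
  \sum_i \sum_j \sum_k - F i j k = - \sum_i \sum_j \sum_k F i j k.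
Proof.
rewrite -sumrN; apply: eq_bigr => i _; rewrite -sumrN; apply: eq_bigr => j _.
by rewrite -sumrN.
Qed.

(** The six terms of the Gram determinant give six copies of T x y z, each by
[trilinear_expand] and with the sign absorbed by the antisymmetry of T. It is used
with the wedge product for T, to expand an element of degree 3, and with the
fundamental trilinear form, to pair [fund3] with a product. *)
Lemma alternating_expand {W : lmodType K} (T : V -> V -> V -> W) :
  (forall y z, linear (fun x => T x y z)) -> (forall x z, linear (fun y => T x y z)) ->
  (forall x y, linear (fun z => T x y z)) ->
  (forall x y z, T y x z = - T x y z) -> (forall x y z, T x z y = - T x y z) ->
  forall x y z, \sum_i \sum_j \sum_k
    ext_form B (ext3 x y z) (ext3 (X i) (X j) (X k)) *: T (X i) (X j) (X k) = 6 *: T x y z.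
Proof.
move=> T1 T2 T3 T12 T23 x y z.
have TE u v w := trilinear_expand T1 T2 T3 u v w.
transitivity (T x y z - T x z y - T y x z + T z x y + T y z x - T z y x); last first.
  rewrite (T12 x z y) (T23 y x z) (T12 y z x) (T23 y x z) (T23 x y z) (T12 x y z) !opprK.
  by rewrite scaler_nat !mulrSr mulr0n add0r.
rewrite -!TE -!sum3_opp -!sum3_add; apply: eq_bigr => i _; apply: eq_bigr => j _.
apply: eq_bigr => k _; rewrite -!scaleNr -!scalerDl ext_form3; congr (_ *: _).
rewrite !(form_sym (X _)); ring.
Qed.

(** Six times the orthogonal projection onto degree 3: every product of three distinct
basis vectors occurs once for each ordering of its factors. *)
Definition project3 v : ext_alg V :=
  \sum_i \sum_j \sum_k ext_form B v (ext3 (X i) (X j) (X k)) *: ext3 (X i) (X j) (X k).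

Lemma project3_linear : linear project3.
Proof.
move=> c a b; rewrite /project3 scaler_sumr -big_split; apply: eq_bigr => i _ /=.
rewrite scaler_sumr -big_split; apply: eq_bigr => j _ /=.
rewrite scaler_sumr -big_split; apply: eq_bigr => k _ /=.
by rewrite (ext_form_linearl form_linear form_sym) scalerDl scalerA.
Qed.

Lemma degree3_expand v : ext_degree 3 v -> project3 v = 6 *: v.
Proof.
case=> m [c [t ->]]; rewrite (linear_comb project3_linear) scaler_sumr.
apply: eq_bigr => a _; rewrite scalerA [6 * _]mulrC -scalerA; congr (_ *: _).
case: (t a) => [[|x [|y [|z [|]]]]] //= _.
rewrite !big_cons big_nil mulr1 mulrA.
apply: alternating_expand.
- exact: ext3_linear1.
- exact: ext3_linear2.
- exact: ext3_linear3.
- exact: ext3_swap12.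
- exact: ext3_swap23.
Qed.

Lemma fund3_degree : ext_degree 3 fund3.
Proof.
exists #|{: 'I_n * 'I_n * 'I_n}|.
exists (fun a => let t := enum_val a in - 12^-1 * str_const t.1.1 t.1.2 t.2).
exists (fun a => let t := enum_val a in [tuple X t.1.1; X t.1.2; X t.2]).
pose G (t : 'I_n * 'I_n * 'I_n) := (- 12^-1 * str_const t.1.1 t.1.2 t.2) *: ext3 (X t.1.1) (X t.1.2) (X t.2).
transitivity (\sum_(t in {: 'I_n * 'I_n * 'I_n}) G t).
  rewrite /fund3 pair_big pair_big scaler_sumr; apply: eq_bigr => t _.
  by rewrite scalerA.
rewrite big_enum_val; apply: eq_bigr => a _.
by rewrite /= !big_cons big_nil mulr1 mulrA.
Qed.

Lemma fund3_form x y z : ext_form B fund3 (ext3 x y z) = - 2^-1 * B x (br y z).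
Proof.
pose Phi : {linear ext_alg V -> K^o} := HB.pack (fun v => ext_form B v (ext3 x y z) : K^o)
  (GRing.isLinear.Build K (ext_alg V) K^o *:%R _ (ext_form_linearl form_linear form_sym (ext3 x y z))).
pose T u v w : K^o := B u (br v w).
transitivity (- 12^-1 *: (6 *: T x y z)); last first.
  rewrite scalerA; congr (_ * _).
  by rewrite mulNr -[12%N]/(2 * 6)%N natrM invfM -mulrA mulVf ?mulr1 ?(natK_neq0 charK0).
rewrite -[LHS]/(Phi fund3) /fund3 linearZ_LR; congr (_ * _).
rewrite -(alternating_expand (T := T)).
- rewrite linear_sum; apply: eq_bigr => i _; rewrite linear_sum; apply: eq_bigr => j _.
  rewrite linear_sum; apply: eq_bigr => k _; rewrite linearZ /= /Phi /= /ext3 !ext_form3.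
  rewrite /T -/(str_const i j k) /GRing.scale /= [RHS]mulrC; congr (_ * _).
  rewrite !(form_sym x) !(form_sym y) !(form_sym z); ring.
- by move=> v w; apply: form_linearl.
- by move=> u w c v v'; rewrite /T linearPl form_linear.
- by move=> u v c w w'; rewrite /T linearPr form_linear.
- by move=> u v w; rewrite /T form_br_rot form_br_swap.
- by move=> u v w; rewrite /T form_br_swap.
Qed.

(** [fund3] satisfies the conditions defining the fundamental form, and by
[degree3_expand] these determine all its coefficients. *)
Lemma fund_formE : fund_form br B = fund3.
Proof.
rewrite /fund_form; set P := (P in xget _ P).
have Pfund3 : P fund3 by split=> [|x y z]; [exact: fund3_degree|exact: fund3_form].
have [dv fv] := xgetPex 0 (ex_intro P _ Pfund3).
move: (xget 0 P) dv fv => v /degree3_expand dv fv.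
have <- : 6^-1 *: (6 *: v) = v by rewrite scalerA mulVf ?scale1r ?(natK_neq0 charK0).
rewrite -dv /project3 /fund3.
have -> : - 12^-1 = 6^-1 * - 2^-1 :> K by rewrite mulrN -invfM -natrM.
rewrite -scalerA; congr (_ *: _).
rewrite scaler_sumr; apply: eq_bigr => i _.
rewrite scaler_sumr; apply: eq_bigr => j _.
rewrite scaler_sumr; apply: eq_bigr => k _.
by rewrite fv scalerA.
Qed.

Let e i : cliff_alg B := cliff_in B (X i).

Lemma str_rot i j k : str_const i j k = str_const j k i.
Proof. exact: form_br_rot. Qed.

Lemma str_swap i j k : str_const i k j = - str_const i j k.
Proof. exact: form_br_swap. Qed.

Lemma str_diag i j : str_const i j j = 0.
Proof. by rewrite /str_const br_alternating linear0r. Qed.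

Lemma cliff_anticomm i j : e i * e j + e j * e i = (2 * (i == j)%:R) *: (1 : cliff_alg B).
Proof. by rewrite cliff_inM X_orthonormal. Qed.

Lemma br_expand j k : br (X j) (X k) = \sum_i str_const i j k *: X i.
Proof. by rewrite [LHS]X_span; apply: eq_bigr => i _; rewrite form_sym. Qed.

Lemma curv_str j k l m : curv str_const j k l m = B (br (X j) (X k)) (br (X l) (X m)).
Proof.
rewrite [in RHS](br_expand j k) (linear_comb (form_linearl (br (X l) (X m)))).
by apply: eq_bigr.
Qed.

Lemma curv_str_bianchi j k l m :
  curv str_const j k l m + curv str_const k l j m + curv str_const l j k m = 0.
Proof. by rewrite !curv_str form_br_bianchi. Qed.

(** For distinct indices the Chevalley map takes the wedge product of orthogonal vectors
to their Clifford product; for repeated indices both sides vanish with f. *)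
Lemma fund_cliffE : fund_cliff br B = - 12^-1 *: cubic e str_const.
Proof.
have CL := chevalley_is_linear B charK0.
pose C : {linear ext_alg V -> cliff_alg B} := HB.pack (chevalley B)
  (GRing.isLinear.Build K _ _ *:%R _ CL).
rewrite /fund_cliff fund_formE -[LHS]/(C fund3) /fund3 linearZ_LR; congr (_ *: _).
rewrite linear_sum; apply: eq_bigr => i _; rewrite linear_sum; apply: eq_bigr => j _.
rewrite linear_sum; apply: eq_bigr => k _; rewrite linearZ_LR.
have [->|ij] := eqVneq i j; first by rewrite str_rot str_rot str_diag !scale0r.
have [->|jk] := eqVneq j k; first by rewrite str_diag !scale0r.
have [->|ki] := eqVneq k i; first by rewrite str_rot str_diag !scale0r.
congr (_ *: _).
have := @chevalley_orthogonal K V B charK0 [:: X i; X j; X k].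
rewrite !big_cons !big_nil !mulr1 !mulrA /= => <- // p q.
case: p q => [|[|[|p]]] [|[|[|q]]] //=; rewrite ?andbF // X_orthonormal => _.
- by rewrite (negPf ij).
- by rewrite eq_sym (negPf ki).
- by rewrite (negPf jk).
Qed.

Definition fund_scalar : K := - 24^-1 * \sum_m ric str_const m m.

(** The factor is 6 / 12^2 = 1 / 24. *)
Lemma sqr_fund_cliff : fund_cliff br B * fund_cliff br B = fund_scalar *: (1 : cliff_alg B).
Proof.
rewrite fund_cliffE -quot_scalerAl -quot_scalerAr scalerA.
rewrite (sqr_cubic charK0 cliff_anticomm str_rot str_swap curv_str_bianchi) scalerA.
congr (_ *: _); rewrite /fund_scalar mulrNN mulrN mulrA [RHS]mulNr; congr (- (_ * _)).
rewrite -[24%N]/(12 * 2)%N natrM invfM -mulrA; congr (_ * _).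
by rewrite -[12%N]/(2 * 6)%N natrM invfM -mulrA mulVf ?mulr1 ?(natK_neq0 charK0).
Qed.

Lemma anticomm_fund_cliff i : e i * fund_cliff br B + fund_cliff br B * e i =
  - 2^-1 *: quadr e str_const i.
Proof.
rewrite fund_cliffE -quot_scalerAl -quot_scalerAr -scalerDr.
rewrite (anticomm_cubic cliff_anticomm str_rot str_swap) scalerA; congr (_ *: _).
by rewrite mulNr -[12%N]/(2 * 6)%N natrM invfM -mulrA mulVf ?mulr1 ?(natK_neq0 charK0).
Qed.

End QuadraticLie.

(** * Orthonormal bases *)

Definition orthonormal_family {K : nzRingType} {V : lmodType K} (B : V -> V -> K) {n} (X : 'I_n -> V) :=
  forall i j, B (X i) (X j) = (i == j)%:R.

Section OrthonormalBasis.
Variables (K : numClosedFieldType) (V : vectType K) (B : {symmetric V}).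
Hypothesis B_nondegenerate : nondegenerate B.

Lemma nondegenerate_ex u : u != 0 -> exists y, B u y != 0.
Proof.
move=> u0; have : u \notin orthov B fullv.
  by rewrite (eqP B_nondegenerate) memv0.
by case/mem_orthovPn => y _ h; exists y.
Qed.

Section Family.
Variables (n : nat) (X : 'I_n -> V).
Hypothesis X_orthonormal : orthonormal_family B X.

Lemma form_comb (c : 'I_n -> K) j : B (\sum_i c i *: X i) (X j) = c j.
Proof.
rewrite (linear_comb (form_linearl B (X j))) (bigD1 j) //= big1 => [|i /negPf ij].
  by rewrite X_orthonormal eqxx addr0; apply: mulr1.
by rewrite X_orthonormal ij; apply: mulr0.
Qed.

Lemma orthonormal_family_size : (n <= \dim {: V})%N.
Proof.
have Xfree : free [tuple X i | i < n].
  apply/freeP => c; rewrite (eq_bigr (fun i => c i *: X i)) => [c0 j|i _].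
    by rewrite -[c j](form_comb c) c0 linear0l.
  by rewrite -tnth_nth tnth_mktuple.
rewrite -[n in (n <= _)%N](size_tuple [tuple X i | i < n]) -(eqP Xfree).
exact/dimvS/subvf.
Qed.

Definition residue x := x - \sum_i B x (X i) *: X i.

Lemma residue_orthogonal x j : B (residue x) (X j) = 0.
Proof. by rewrite linearBl /= (form_comb (fun i => B x (X i))) subrr. Qed.

(** Gram-Schmidt step. The residue u of x may be isotropic, but non-degeneracy gives a
vector y' orthogonal to the family and pairing non-trivially with u; one of u, y' and
u + y' is then not isotropic, and can be normalised with a square root. *)
Lemma orthonormal_family_extend x : residue x != 0 ->
  exists Y : 'I_n.+1 -> V, orthonormal_family B Y.
Proof.
move=> x0; have [w [wX ww]] : exists w, (forall i, B w (X i) = 0) /\ B w w != 0.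
  have uX := residue_orthogonal x.
  case: (nondegenerate_ex x0) => y uy.
  move: (residue x) uX uy {x0} => u uX uy.
  have uy' : B u (residue y) != 0.
    rewrite linearBr /= (linear_comb (form_linear B u) (fun i => B y (X i)) X) big1 ?subr0 // => i _.
    by rewrite uX; apply: mulr0.
  (* Subtracting the projection of y does not change its pairing with u. *)
  have yX := residue_orthogonal y.
  move: (residue y) uy' yX => y' uy' yX {uy}.
  have [uu|uu] := eqVneq (B u u) 0; last by exists u.
  have [vv|vv] := eqVneq (B y' y') 0; last by exists y'.
  exists (u + y'); split=> [i|]; first by rewrite linearDl /= uX yX addr0.
  rewrite linearDl /= !linearDr /= uu vv /= add0r addr0 (form_sym B y') -mulr2n.
  by rewrite mulrn_eq0.
pose w0 := (sqrtC (B w w))^-1 *: w.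
have w0X i : B w0 (X i) = 0 by rewrite linearZl_LR /= wX; apply: mulr0.
have w00 : B w0 w0 = 1.
  rewrite linearZl_LR linearZr_LR /= [LHS]mulrA -invfM -expr2 sqrtCK.
  exact: mulVf.
exists (fun i => oapp X w0 (unlift ord0 i)) => i j.
case: (unliftP ord0 i) => [i' ->|->]; case: (unliftP ord0 j) => [j' ->|->];
  rewrite ?liftK ?unlift_none /= ?X_orthonormal ?(inj_eq lift_inj) //.
by rewrite form_sym w0X.
Qed.
End Family.

(** Otherwise every orthonormal family could be extended, up to a length that exceeds
the dimension. *)
Lemma orthonormal_basis_exists : exists n (X : 'I_n -> V),
  orthonormal_family B X /\ forall x, x = \sum_i B x (X i) *: X i.
Proof.
apply: contrapT => noX.
suff [Y /orthonormal_family_size] : exists Y : 'I_(\dim {: V}).+1 -> V, orthonormal_family B Y.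
  by rewrite ltnn.
elim: (\dim {: V}).+1 => [|n [X oX]]; first by exists (fun _ => 0); case.
apply: contrapT => noY; apply: noX; exists n, X; split=> // x.
apply/eqP; rewrite -subr_eq0; apply: contrapT => /negP x0; apply: noY.
exact: orthonormal_family_extend x0.
Qed.

Lemma orthonormal_nth (X : seq V) : orthonormal B X ->
  orthonormal_family B (fun i : 'I_(size X) => X`_i).
Proof.
case/andP => /allP nX oX.
have lt i j : (i < j < size X)%N -> B X`_i X`_j = 0.
  elim: X oX {nX} i j => [|x X IH] /= => [_ i j|]; first by rewrite ltn0 andbF.
  case/andP; rewrite /= andbT => /allP xX /IH{}IH [|i] [|j] //= h; last exact: IH.
  by apply/eqP/xX/mem_nth; rewrite -ltnS.
move=> i j; case: (ltngtP i j) => [ij|ji|/val_inj ->].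
- by rewrite lt ?ij ?ltn_ord // -val_eqE ltn_eqF.
- by rewrite form_sym lt ?ji ?ltn_ord // -val_eqE gtn_eqF.
- by rewrite eqxx; apply/eqP/nX/mem_nth.
Qed.

Lemma orthonormal_basis_span (X : seq V) : basis_of fullv X -> orthonormal B X ->
  forall x, x = \sum_(i < size X) B x X`_i *: X`_i.
Proof.
move=> /andP[/eqP spanX _] /orthonormal_nth oX x.
have xX : x \in <<in_tuple X>>%VS by rewrite spanX memvf.
rewrite [LHS](coord_span xX); apply: eq_bigr => j _; congr (_ *: _).
by rewrite {2}(coord_span xX) (form_comb oX (fun i => coord (in_tuple X) i x)).
Qed.
End OrthonormalBasis.

(** * The square of the cubic Dirac operator *)

Lemma sqr_dirac_operator (K : fieldType) (V : lmodType K) (br : {bilinear V -> V -> V})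
    (B : {symmetric V}) (charK0 : [pchar K] =i pred0)
    (br_alternating : forall x, br x x = 0)
    (B_invariant : forall x y z, B (br x y) z + B y (br x z) = 0)
    (X : seq V) (oX : orthonormal_family B (fun i : 'I_(size X) => X`_i))
    (spanX : forall x, x = \sum_(i < size X) B x X`_i *: X`_i) (c : K) :
  fund_cliff br B * fund_cliff br B = c *: (1 : cliff_alg B) ->
  dirac br B X * dirac br B X = tensor (casimir br X) (1 : cliff_alg B) +
    c *: tensor (1 : env_alg br) (1 : cliff_alg B).
Proof.
pose Y (i : 'I_(size X)) := X`_i.
pose E i := env_in br (Y i); pose e i := cliff_in B (Y i).
have -> : dirac br B X = \sum_i tensor (E i) (e i) + tensor 1 (fund_cliff br B).
  by rewrite /dirac (big_nth 0) big_mkord.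
have -> : casimir br X = \sum_i E i ^+ 2 by rewrite /casimir (big_nth 0) big_mkord.
move=> vv.
have E_bracket i j : E i * E j - E j * E i = \sum_k str_const br B Y k i j *: E k.
  by rewrite env_inM (br_expand br spanX) (linear_comb (env_in_is_linear br)).
have ev := anticomm_fund_cliff charK0 br_alternating B_invariant oX spanX.
have DD := sqr_dirac charK0 E_bracket (cliff_anticomm oX) vv ev.
exact: DD.
Qed.

Theorem mainTheorem1 (R : realType) (g : vectType R[i])
    (br : {bilinear g -> g -> g}) (B : {symmetric g})
    (br_alternating : forall x, br x x = 0)
    (br_jacobi : forall x y z, br x (br y z) + br y (br z x) + br z (br x y) = 0)
    (B_nondegenerate : nondegenerate B)
    (B_invariant : forall x y z, B (br x y) z + B y (br x z) = 0) :
  exists c : R[i],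
    fund_cliff br B * fund_cliff br B = c *: (1 : cliff_alg B) /\
    forall X : seq g, basis_of fullv X -> orthonormal B X ->
      dirac br B X * dirac br B X =
        tensor (casimir br X) (1 : cliff_alg B) +
        c *: tensor (1 : env_alg br) (1 : cliff_alg B).
Proof.
have charK0 : [pchar R[i]] =i pred0 := pchar_num _.
have [n [Y [oY spanY]]] := orthonormal_basis_exists B_nondegenerate.
have vv := sqr_fund_cliff charK0 br_alternating br_jacobi B_invariant oY spanY.
exists (fund_scalar br B Y); split=> [|X basisX onX]; first exact: vv.
have oX := orthonormal_nth onX; have spanX := orthonormal_basis_span basisX onX.
exact: (sqr_dirac_operator charK0 br_alternating B_invariant oX spanX vv).
Qed.
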